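(* Assume that $\mathcal K$ contains the field of rational functions $\mathbb C(x)$. Let $Y$ be a rational vector field on $\mathbb{CP}_1\times\mathbb C^n$ which is a non-characteristic infinitesimal symmetry of $X$ and whose polar subset does not include the curve $\mathcal U\times\{0\}$ in $\mathcal U\times\mathbb C^n$. Consider the Maclaurin series (with respect to $y_1,\ldots,y_n$) $$Y-(Yx)X=Y_0+Y_1+Y_2+\cdots,$$ where each $Y_r$ is a homogeneous polynomial vertical vector field of degree $r$. Then $Y_r\in\mathbf{sym}^r_X(\mathcal K)$ for each $r$, and $Y_r$ is not zero for at least one index $r$.
   Context: Let $\mathcal U$ be a nonempty connected open subset of $\mathbb{CP}_1$ with affine coordinate $x$. A function field $\mathcal K$ is a subfield of the field of meromorphic functions on $\mathcal U$ that contains the constants $\mathbb C$ and is closed under $\frac{d}{dx}$; fix one. Fix $n\ge 1$ and $A(x)=(a_{ij}(x))\in\mathfrak{gl}(n,\mathcal K)$, and consider the linear system $\frac{dy}{dx}=A(x)y$, $y=(y_1,\ldots,y_n)$, with associated meromorphic vector field on $\mathcal U\times\mathbb C^n$ $$X=\frac{\partial}{\partial x}+\sum_{i,j=1}^n a_{ij}(x)y_j\frac{\partial}{\partial y_i}.$$ An infinitesimal symmetry of $X$ is an analytic vector field $Y$ defined on some open subset of $\mathcal U\times\mathbb C^n$ such that $[Y,X]$ and $X$ are linearly dependent on their common domain of definition. It is characteristic if $Y=\gamma X$ for some analytic function $\gamma$, and non-characteristic otherwise. A rational vector field is regarded as an analytic vector field off its polar subset. The Maclaurin series is the power series expansion in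 $y$ along $y=0$, with coefficients that are functions of $x$. A homogeneous polynomial vertical vector field of degree $r$ is a vector field $\sum_i P_i(x,y)\frac{\partial}{\partial y_i}$ whose components $P_i$ are homogeneous polynomials of degree $r$ in $y_1,\ldots,y_n$; it has coefficients in $\mathcal K$ if each $P_i\in\mathcal K[y_1,\ldots,y_n]$. $\mathbf{sym}^r_X(\mathcal K)$ denotes the set of homogeneous polynomial vertical vector fields $Z$ of degree $r$ with coefficients in $\mathcal K$ satisfying $[X,Z]=0$.
   Formalization: Non-characteristic is read over finite x: Y is not γX with γ analytic off x = ∞. If γ must also be analytic at ∞, the claim fails for n=1, A=0, Y = −x² d/dx, where Y−(Yx)X = 0; dependence and poles are likewise tested at finite x. *)

(* Defs.v *)
From HB Require Import structures.
From mathcomp Require Import all_boot all_order all_algebra.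
From mathcomp Require Import fraction complex mpoly.
From mathcomp Require Import all_classical all_reals all_analysis.

Set Implicit Arguments.
Unset Strict Implicit.
Unset Printing Implicit Defensive.

Import GRing.Theory Num.Theory.
Import numFieldNormedType.Exports.

Local Open Scope classical_set_scope.
Local Open Scope ring_scope.
Local Open Scope complex_scope.

(** The field of complex numbers, with the topology of its norm. *)
Definition C (R : realType) : numClosedFieldType := R[i].

(** The Riemann sphere with its affine coordinate: [Some x] is the point with
    coordinate [x], and [None] is the point at infinity. *)
Definition CP1 (R : realType) := one_point_compactification (C R).

Definition affine_part (R : realType) (U : set (CP1 R)) : set (C R) :=
  [set x | U (Some x)].

(** Over the complex numbers, [differentiable] means complex differentiable. *)
Definition analytic_at (R : realType) (V W : normedModType (C R)) (f : V -> W)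
    (a : V) : Prop :=
  \forall z \near a, differentiable f z.

(** * Meromorphic functions of one variable

    A meromorphic function on [U] is represented by a function [C R -> C R]
    of the affine coordinate.  The representatives of a given meromorphic
    function differ by arbitrary values outside [U] and at isolated points of
    [U] (in particular at the poles); [mero_eq] is equality of the meromorphic
    functions represented. *)

(** [f] in the local coordinate [x - a] at [Some a], and [1 / x] at infinity. *)
Definition in_chart (R : realType) (p : CP1 R) (f : C R -> C R) (w : C R) :
    C R :=
  if p is Some a then f (a + w) else f w^-1.

Definition mero_eq (R : realType) (U : set (CP1 R)) (f g : C R -> C R) :
    Prop :=
  forall p, U p -> \forall w \near (0 : C R)^', in_chart p f w = in_chart p g w.

(** Laurent expansion with finite principal part at every point of [U]. *)
Definition meromorphic (R : realType) (U : set (CP1 R)) (f : C R -> C R) :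
    Prop :=
  forall p, U p -> exists (m : nat) (c : nat -> C R),
    \forall w \near (0 : C R)^',
      series (fun k => c k * w ^+ k) @ \oo --> w ^+ m * in_chart p f w.

(** [K] is the set of all representatives of the elements of the field, hence
    the clause [ff_sat]. *)
Record function_field (R : realType) (U : set (CP1 R))
    (K : set (C R -> C R)) : Prop := FunctionField {
  ff_mero : forall f, K f -> meromorphic U f;
  ff_sat : forall f g, K f -> mero_eq U f g -> K g;
  ff_const : forall c : C R, K (fun=> c);
  ff_sub : forall f g, K f -> K g -> K (fun x => f x - g x);
  ff_mul : forall f g, K f -> K g -> K (fun x => f x * g x);
  ff_inv : forall f, K f -> K (fun x => (f x)^-1);
  ff_derive : forall f, K f -> K (derive1 f)
}.

(** * Vector fields in the coordinates [(x, y)] *)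

Definition phase (R : realType) (n : nat) := (C R * 'rV[C R]_n)%type.

(** [v q] is the row of coefficients at [q] of
    [d/dx, d/dy_1, ..., d/dy_n]. *)
Definition vfield (R : realType) (n : nat) := phase R n -> phase R n.

(** The component along [d/du] is [v(w_u) - w(v_u)]. *)
Definition lie_bracket (R : realType) (n : nat) (v w : vfield R n) :
    vfield R n :=
  fun q => 'D_(v q) w q - 'D_(w q) v q.

Definition dependent_at (R : realType) (n : nat) (v w : vfield R n)
    (q : phase R n) : Prop :=
  exists a b : C R, (a, b) != (0, 0) /\ a *: v q + b *: w q = 0.

Definition system_field (R : realType) (n : nat) (A : 'M[C R -> C R]_n) :
    vfield R n :=
  fun q => (1, \row_i \sum_j A i j q.1 * q.2 0 j).

(** The points over the affine part of [U] at which the entries of [A] are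
    analytic.  Points over infinity are left out: there [d/dx] vanishes to
    order 2, so that dependence over the analytic functions would change its
    meaning. *)
Definition system_dom (R : realType) (n : nat) (U : set (CP1 R))
    (A : 'M[C R -> C R]_n) : set (phase R n) :=
  [set q | affine_part U q.1 /\ forall i j, analytic_at (A i j) q.1].

Definition infinitesimal_symmetry (R : realType) (n : nat) (U : set (CP1 R))
    (A : 'M[C R -> C R]_n) (D : set (phase R n)) (Y : vfield R n) : Prop :=
  [/\ open D,
      D `<=` [set q | affine_part U q.1],
      (forall q, D q -> analytic_at Y q) &
      forall q, D q -> system_dom U A q ->
        dependent_at (lie_bracket Y (system_field A)) (system_field A) q].

Definition characteristic (R : realType) (n : nat) (U : set (CP1 R))
    (A : 'M[C R -> C R]_n) (D : set (phase R n)) (Y : vfield R n) : Prop :=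
  exists gamma : phase R n -> C R,
    forall q, D q -> system_dom U A q ->
      analytic_at gamma q /\ Y q = gamma q *: system_field A q.

(** * Rational vector fields on CP1 x C^n *)

(** Variable [ord0] stands for [x] and variable [lift ord0 i] for [y_i]. *)
Definition ratfun (R : realType) (n : nat) :=
  {fraction {mpoly (C R)[1 + n]}}.

Definition coords (R : realType) (n : nat) (q : phase R n) : 'I_(1 + n) -> C R :=
  fun i => row_mx (q.1)%:M q.2 0 i.

(** A rational function is regular at [q] when some fraction representing it has
    a denominator that does not vanish at [q]. *)
Definition ratfun_value (R : realType) (n : nat) (f : ratfun R n)
    (q : phase R n) (v : C R) : Prop :=
  exists P Q : {mpoly (C R)[1 + n]},
    [/\ Q.@[coords q] != 0,
        f = tofrac P / tofrac Q &
        v = P.@[coords q] / Q.@[coords q]].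

Definition ratfun_eval (R : realType) (n : nat) (f : ratfun R n)
    (q : phase R n) : C R :=
  xget 0 [set v | ratfun_value f q v].

Definition ratfun_polar (R : realType) (n : nat) (f : ratfun R n) :
    set (phase R n) :=
  [set q | ~ exists v, ratfun_value f q v].

(** The coefficient of [d/dx] and those of the [d/dy_i]. *)
Definition rat_vfield (R : realType) (n : nat) :=
  (ratfun R n * ('I_n -> ratfun R n))%type.

Definition rat_field (R : realType) (n : nat) (Y : rat_vfield R n) :
    vfield R n :=
  fun q => (ratfun_eval Y.1 q, \row_i ratfun_eval (Y.2 i) q).

Definition polar_set (R : realType) (n : nat) (Y : rat_vfield R n) :
    set (phase R n) :=
  ratfun_polar Y.1 `|` \bigcup_i ratfun_polar (Y.2 i).

Definition rat_dom (R : realType) (n : nat) (U : set (CP1 R))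
    (Y : rat_vfield R n) : set (phase R n) :=
  [set q | affine_part U q.1 /\ ~ polar_set Y q].

(** Restricted to finite [x]; since polar sets are closed, the polar set contains
    the whole curve over [U] as soon as it contains this part. *)
Definition zero_curve (R : realType) (n : nat) (U : set (CP1 R)) :
    set (phase R n) :=
  [set q | affine_part U q.1 /\ q.2 = 0].

(** * Polynomial vertical vector fields *)

(** Polynomials in [y] whose coefficients are functions of [x]. *)
Definition poly_vfield (R : realType) (n : nat) :=
  'I_n -> {mpoly (C R -> C R)[n]}.

Definition vertical_field (R : realType) (n : nat) (Z : poly_vfield R n) :
    vfield R n :=
  fun q => (0, \row_i mmap (fun c => c q.1) (fun j => q.2 0 j) (Z i)).

Definition homogeneous (R : realType) (n : nat) (r : nat)
    (Z : poly_vfield R n) : Prop :=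
  forall i, Z i \is r.-homog.

Definition poly_dom (R : realType) (n : nat) (U : set (CP1 R))
    (Z : poly_vfield R n) : set (phase R n) :=
  [set q | affine_part U q.1 /\
           forall i m, analytic_at (Z i)@_m q.1].

Definition poly_vfield_zero (R : realType) (n : nat) (U : set (CP1 R))
    (Z : poly_vfield R n) : Prop :=
  forall i m, mero_eq U (Z i)@_m (fun=> 0).

Definition sym (R : realType) (n : nat) (U : set (CP1 R))
    (K : set (C R -> C R)) (A : 'M[C R -> C R]_n) (r : nat)
    (Z : poly_vfield R n) : Prop :=
  [/\ homogeneous r Z,
      (forall i m, K (Z i)@_m) &
      forall q, system_dom U A q -> poly_dom U Z q ->
        lie_bracket (system_field A) (vertical_field Z) q = 0].

(** [W = Z 0 + Z 1 + ...] near [y = 0] over each [x] such that [(x, 0)] is in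
    [D], with [Z r] homogeneous of degree [r] in [y]. *)
Definition maclaurin (R : realType) (n : nat) (D : set (phase R n))
    (W : vfield R n) (Z : nat -> poly_vfield R n) : Prop :=
  (forall r, homogeneous r (Z r)) /\
  forall x : C R, D (x, 0) ->
    \forall y \near (0 : 'rV[C R]_n),
      series (fun r => vertical_field (Z r) (x, y)) @ \oo --> W (x, y).

(* Main.v *)
Require Import Defs.
From HB Require Import structures.
From mathcomp Require Import all_boot all_order all_algebra.
From mathcomp Require Import fraction complex mpoly.
From mathcomp Require Import all_classical all_reals all_analysis.
From mathcomp Require Import ring zify.

Set Implicit Arguments.
Unset Strict Implicit.
Unset Printing Implicit Defensive.

Import Order.TTheory GRing.Theory Num.Theory.
Import numFieldNormedType.Exports.

Local Open Scope classical_set_scope.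
Local Open Scope ring_scope.
Local Open Scope complex_scope.


(** Write Y = eta d/dx + sum_i V_i d/dy_i, with eta and the V_i rational.  Subtracting
    eta X leaves a vertical field W = Y - eta X.  If [Y, X] is a multiple of X, the
    d/dx-component shows that [Y, X] = - X(eta) X; since also [eta X, X] = - X(eta) X, it
    follows that [W, X] = 0.

    Let Q be a common denominator of eta and the V_i that does not vanish at some
    (x0, 0), and let N = Q W.  The components of N are polynomials in y with
    coefficients in K, and so is Q.  All comparisons are made on lines y = t v, over
    the regular points x, those where Q(x, 0) <> 0 and A is analytic: there
    W(x, t v) = sum_r t^r Y_r(x, v), and Q(x, t v) and N(x, t v) are polynomials
    in t, so that identities between analytic functions become identities between
    the coefficients of powers of t, by uniqueness of power series in one variable.

    - From Q W = N comes the triangular recurrence N_r = sum_k Q_k Y_(r-k) for the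
      homogeneous parts [den_mul_recurrence], which can be solved because
      Q_0 = Q(x, 0) is invertible in K.  Hence, over the regular points, the
      coefficients of Y_r are elements of K [Yr_regular].
    - The equation [W, X] = 0 multiplied by Q^2 is an identity between N and Q
      [numerator_pde].  The derivative along X preserves the degree in y, so this
      identity splits into homogeneous parts; compared with the derivative of the
      recurrence, it says that [X, Y_r] satisfies a recurrence without right-hand
      side, whence [X, Y_r] = 0 [Yr_flow].
    - If every Y_r vanishes, so does N, hence W vanishes off the zeros of Q, hence
      everywhere by continuity, and Y = eta X is characteristic [Yr_nonzero].

    The points that are not regular are isolated, even in the neighbourhood of
    infinity: Q(x, 0) is a nonzero polynomial, and a meromorphic function is
    analytic on punctured neighbourhoods [meromorphic_analytic].  Since K is
    saturated for equality of meromorphic functions, the coefficients of Y_r belong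
    to K.  The equation [X, Y_r] = 0 extends to the points that are not regular but
    where A and Y_r are analytic, because the derivatives of the coefficients are
    continuous there [derive1_meromorphic_continuous]: meromorphic functions are
    given by Laurent series, so that term by term differentiation replaces Cauchy's
    formula. *)

(** * Power series over the complex numbers *)

Lemma norm_cvg_le (R : realType) (u : nat -> C R) (l b : C R) :
  u @ \oo --> l -> (forall n, `|u n| <= b) -> `|l| <= b.
Proof.
move=> ul ub; have b0 : b \is Num.real.
  by apply/ger0_real/(le_trans (normr_ge0 (u 0%N)))/ub.
rewrite real_leNgt ?normr_real//; apply/negP => bl.
have e0 : 0 < `|l| - b by rewrite subr_gt0.
move/cvgrPdist_lt: ul => /(_ _ e0)[N _ /(_ N (leqnn N))].
have : `|l| - b <= `|l - u N|; last by move=> /le_lt_trans h /h; rewrite ltxx.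
rewrite lerBlDr -{1}(subrK (u N) l).
by rewrite (le_trans (ler_normD _ _))// lerD2l.
Qed.

Lemma series_Re_Im (R : realType) (a : nat -> C R) n :
  series a n = (series (fun k => complex.Re (a k)) n)%:C
             + 'i%C * (series (fun k => complex.Im (a k)) n)%:C.
Proof.
rewrite /series /= !rmorph_sum /= mulr_sumr -big_split /=.
by apply: eq_bigr => k _; exact: complexE.
Qed.

Lemma cvg_real_complex (R : realType) (u : nat -> R) (l : R) :
  u @ \oo --> l -> (fun n => (u n)%:C : C R) @ \oo --> (l%:C : C R).
Proof.
move=> ul; apply/cvgrPdist_lt => e e0.
have er : e = (complex.Re e)%:C by rewrite RRe_real// gtr0_real.
have re0 : 0 < complex.Re e by rewrite -ltcR -er.
near=> n; rewrite -rmorphB /= er.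
have -> : `|(l - u n)%:C| = `|l - u n|%:C.
  by rewrite normc_def /= expr0n addr0 sqrtr_sqr.
rewrite ltcR; near: n; move: ul => /cvgrPdist_lt; exact.
Unshelve. all: by end_near. Qed.

Lemma series_half (R : numFieldType) n :
  \sum_(0 <= k < n) (2^-1 : R) ^+ k = 2 - 2 * 2^-1 ^+ n.
Proof.
elim: n => [|n IH]; first by rewrite big_nil expr0 mulr1 subrr.
rewrite big_nat_recr//= IH exprS mulrA divff ?mul1r; last by rewrite pnatr_eq0.
by ring.
Qed.

(** Comparison with the geometric series of ratio 1/2.  Completeness enters here, through
    the real and imaginary parts; the bound on the sum is what makes estimates of
    remainders uniform. *)
Lemma cvg_series_half (R : realType) (a : nat -> C R) (b : C R) :
  (forall k, `|a k| <= b * 2^-1 ^+ k) ->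
  exists2 l, series a @ \oo --> l & `|l| <= 2 * b.
Proof.
move=> ab.
have b0 : 0 <= b by have := le_trans (normr_ge0 _) (ab 0%N); rewrite expr0 mulr1.
have br : b = (complex.Re b)%:C by rewrite RRe_real// ger0_real.
have half_real k : ((2^-1 : R) ^+ k)%:C = (2^-1 : C R) ^+ k.
  by rewrite rmorphXn /= fmorphV rmorph_nat.
have real_cvg (u : nat -> R) : (forall k, `|u k|%:C <= `|a k|) -> cvgn (series u).
  move=> ua; apply: normed_cvg.
  apply: (@series_le_cvg _ _ (geometric (complex.Re b) 2^-1)) => [k|k|k|] /=.
  - exact: normr_ge0.
  - by rewrite mulr_ge0 ?exprn_ge0 ?invr_ge0 ?ler0n// -lecR -br.
  - by rewrite -lecR (le_trans (ua k))// rmorphM /= -br half_real ab.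
  - apply: is_cvg_geometric_series.
    by rewrite ger0_norm ?invr_ge0 ?ler0n// invf_lt1 ?ltr0n// ltr1n.
have cRe : cvgn (series (fun k => complex.Re (a k))).
  by apply: real_cvg => k; exact: normc_ge_Re.
have cIm : cvgn (series (fun k => complex.Im (a k))).
  apply: real_cvg => k.
  have -> : complex.Im (a k) = - complex.Re (a k * 'i%C) by rewrite ReiNIm opprK.
  rewrite normrN (le_trans (normc_ge_Re _))// normrM.
  by rewrite [X in _ * X](_ : _ = 1) ?mulr1// normc_def /= expr0n add0r expr1n sqrtr1.
have al : cvgn (series a).
  rewrite (funext (@series_Re_Im _ a)).
  apply: is_cvgD.
    apply/cvg_ex; exists (limn (series (fun k => complex.Re (a k))))%:C.
    exact: cvg_real_complex cRe.
  apply: is_cvgM; first exact: is_cvg_cst.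
  apply/cvg_ex; exists (limn (series (fun k => complex.Im (a k))))%:C.
  exact: cvg_real_complex cIm.
exists (limn (series a)) => //; apply: norm_cvg_le al _ => n.
rewrite (le_trans (ler_norm_sum _ _ _))//.
rewrite (le_trans (ler_sum _ (fun k _ => ab k)))// -mulr_sumr mulrC.
by rewrite series_half ler_wpM2r// gerBl mulr_ge0// ?exprn_ge0 ?invr_ge0 ?ler0n.
Qed.

Definition psum (R : realType) (c : nat -> C R) (w : C R) : C R :=
  limn (series (fun k => c k * w ^+ k)).

Definition pderiv (R : realType) (c : nat -> C R) k : C R := k.+1%:R * c k.+1.

(** Cauchy's estimates on the circle of radius [r].  They are lossy but stable under
    [pderiv] at the price of halving [r], which is all that local statements need. *)
Definition growth (R : realType) (c : nat -> C R) (r M : C R) :=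
  0 < r /\ forall k, `|c k| * r ^+ k <= M.

Lemma cvg_growth (R : realType) (c : nat -> C R) (w l : C R) :
  w != 0 -> series (fun k => c k * w ^+ k) @ \oo --> l ->
  exists M, growth c `|w| M.
Proof.
move=> w0 cw.
have [M [Mr MM]] : bounded_fun (fun k => c k * w ^+ k).
  apply: cvg_seq_bounded; apply/cvg_ex; exists 0.
  by apply: cvg_series_cvg_0; apply/cvg_ex; exists l.
exists (`|M| + 1); split=> [|k]; first by rewrite normr_gt0.
rewrite -normrX -normrM; apply: (MM (`|M| + 1)) => //.
by rewrite (le_lt_trans (real_ler_norm _))// ltrDl.
Qed.

Lemma growth_series (R : realType) (c : nat -> C R) (r M w : C R) :
  growth c r M -> `|w| <= r / 2 ->
  forall k, `|c k * w ^+ k| <= M * 2^-1 ^+ k.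
Proof.
move=> [r0 cM] wr k; rewrite normrM normrX.
have : `|w| ^+ k <= (r / 2) ^+ k by rewrite lerXn2r// ?nnegrE// ?divr_ge0// ltW.
move=> /(ler_wpM2l (normr_ge0 (c k))) /le_trans; apply.
by rewrite exprMn mulrA ler_wpM2r// exprn_ge0 ?invr_ge0.
Qed.

Lemma psum_cvg (R : realType) (c : nat -> C R) (r M w : C R) :
  growth c r M -> `|w| <= r / 2 ->
  series (fun k => c k * w ^+ k) @ \oo --> psum c w.
Proof.
by move=> cM wr; have [l cl _] := cvg_series_half (growth_series cM wr);
  apply/cvg_ex; exists l.
Qed.

Lemma psum0 (R : realType) (c : nat -> C R) : psum c 0 = c 0%N.
Proof.
apply/cvg_lim => //; apply/cvgrPdist_lt => e e0.
near=> n; rewrite /series /=.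
have -> : n = n.-1.+1 by rewrite prednK//; near: n; exact: nbhs_infty_gt.
rewrite big_nat_recl// expr0 mulr1 big1 ?addr0 ?subrr ?normr0// => k _.
by rewrite exprS mul0r mulr0.
Unshelve. all: by end_near. Qed.

(** [k.+1 <= 2 ^ k] absorbs the factor introduced by differentiation. *)
Lemma growth_pderiv (R : realType) (c : nat -> C R) (r M : C R) :
  growth c r M -> growth (pderiv c) (r / 2) (M / r).
Proof.
move=> [r0 cM]; split=> [|k]; first by rewrite divr_gt0.
rewrite ler_pdivlMr// /pderiv normrM normr_nat.
apply: le_trans (cM k.+1).
rewrite [leLHS](_ : _ = (`|c k.+1| * r ^+ k.+1) * (k.+1%:R * 2^-1 ^+ k)); last first.
  by rewrite exprMn exprS; ring.
rewrite ler_piMr// ?mulr_ge0// ?exprn_ge0 ?(ltW r0)//.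
rewrite exprVn ler_pdivrMr ?exprn_gt0// mul1r -natrX ler_nat.
exact: ltn_expl.
Qed.

(** The factor [p ^+ 2] on the left avoids the exponent [k - 2] and its exceptional cases. *)
Lemma pow_taylor (K : numFieldType) (w h p : K) k :
  `|w| <= p -> `|w + h| <= p ->
  `|(w + h) ^+ k - w ^+ k - h * (k%:R * w ^+ k.-1)| * p ^+ 2
    <= k%:R ^+ 2 * `|h| ^+ 2 * p ^+ k.
Proof.
move=> wp whp; have p0 : 0 <= p by exact: le_trans wp.
elim: k => [|k IH].
  by rewrite !expr0 mul0r mulr0 subr0 subrr normr0 expr0n !mul0r.
rewrite [X in `|X|](_ : _ = (w + h) * ((w + h) ^+ k - w ^+ k - h * (k%:R * w ^+ k.-1))
   + h ^+ 2 * (k%:R * w ^+ k.-1)); last first.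
  case: k {IH} => [|k] /=; first by rewrite !expr1 !expr0; ring.
  rewrite [(w + h) ^+ k.+2]exprS [w ^+ k.+2]exprS [w ^+ k.+1]exprS -[k.+2%:R]natr1.
  by move: (w ^+ k) ((w + h) ^+ k.+1) k.+1%:R => v u x; ring.
apply: le_trans (ler_wpM2r (exprn_ge0 _ p0) (ler_normD _ _)) _.
rewrite mulrDl.
apply: (@le_trans _ _ (p * (k%:R ^+ 2 * `|h| ^+ 2 * p ^+ k)
    + k%:R * `|h| ^+ 2 * p ^+ k.+1)).
  apply: lerD.
    by rewrite normrM -mulrA ler_pM// mulr_ge0// exprn_ge0.
  case: k {IH} => [|k] /=; first by rewrite !mul0r mulr0 normr0 mul0r.
  rewrite !normrM normr_nat !normrX [leLHS](_ : _ = k.+1%:R * `|h| ^+ 2 * (`|w| ^+ k * p ^+ 2)); last by ring.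
  rewrite ler_wpM2l// ?mulr_ge0// ?exprn_ge0//.
  rewrite [p ^+ k.+2](_ : _ = p ^+ k * p ^+ 2); last by rewrite -exprD addn2.
  by rewrite ler_wpM2r ?exprn_ge0// lerXn2r.
rewrite [leLHS](_ : _ = (k%:R ^+ 2 + k%:R) * (`|h| ^+ 2 * p ^+ k.+1)); last first.
  by rewrite [p ^+ k.+1]exprS; ring.
rewrite -mulrA ler_wpM2r// ?mulr_ge0 ?exprn_ge0//.
by rewrite -natrX -natrD -natrX ler_nat; nia.
Qed.

Lemma sqr_le_exp2 k : (k ^ 2 <= 2 * 2 ^ k)%N.
Proof.
case: k => [|[|[|k]]]//.
elim: k => [//|k IH]; rewrite [(2 ^ k.+4)%N]expnS; nia.
Qed.

Lemma sqr_geometric_le (K : numFieldType) k :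
  k%:R ^+ 2 * 4^-1 ^+ k <= 2 * 2^-1 ^+ k :> K.
Proof.
rewrite -natrX !exprVn ler_pdivrMr ?exprn_gt0//.
rewrite mulrAC ler_pdivlMr ?exprn_gt0// -!natrX -!natrM ler_nat.
by rewrite (_ : 4 = 2 * 2)%N// expnMn mulnA leq_mul2r sqr_le_exp2 orbT.
Qed.

(** The remainders of the terms, bounded by [pow_taylor], are dominated on the disk of radius
    [r / 4] by a multiple of [k ^ 2 / 4 ^ k], hence by a geometric series. *)
Lemma psum_taylor (R : realType) (c : nat -> C R) (r M w h : C R) :
  growth c r M -> `|w| <= r / 4 -> `|w + h| <= r / 4 ->
  `|psum c (w + h) - psum c w - h * psum (pderiv c) w|
     <= 4 * (M / (r / 4) ^+ 2) * `|h| ^+ 2.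
Proof.
move=> cM wr whr; have [r0 Mc] := cM.
set p := r / 4 in wr whr *.
have p0 : 0 < p by rewrite divr_gt0.
have pr2 : p <= r / 2 by rewrite ler_pM2l// lef_pV2 ?posrE// ler_nat.
(* The estimates for [pderiv c] hold on half the radius, hence the choice of [r / 4]. *)
have pr22 : p <= (r / 2) / 2 by rewrite /p -mulrA -invfM -natrM.
pose a k := c k * ((w + h) ^+ k - w ^+ k - h * (k%:R * w ^+ k.-1)).
have ab k : `|a k| <= (2 * (M / p ^+ 2) * `|h| ^+ 2) * 2^-1 ^+ k.
  rewrite [leRHS](_ : _ = (2 * M * `|h| ^+ 2 * 2^-1 ^+ k) / p ^+ 2); last by ring.
  rewrite ler_pdivlMr ?exprn_gt0// /a normrM -[leLHS]mulrA.
  apply: le_trans (ler_wpM2l (normr_ge0 _) (pow_taylor k wr whr)) _.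
  rewrite [leLHS](_ : _ = (`|c k| * r ^+ k) * (k%:R ^+ 2 * 4^-1 ^+ k * `|h| ^+ 2)); last first.
    by rewrite /p exprMn; ring.
  apply: (@le_trans _ _ (M * (k%:R ^+ 2 * 4^-1 ^+ k * `|h| ^+ 2))).
    by rewrite ler_wpM2r// !mulr_ge0// ?exprn_ge0 ?invr_ge0.
  rewrite [leRHS](_ : _ = M * (2 * 2^-1 ^+ k * `|h| ^+ 2)); last by ring.
  apply: ler_wpM2l; first by rewrite (le_trans _ (Mc 0%N))// mulr_ge0// exprn_ge0// ltW.
  by apply: ler_wpM2r; [rewrite exprn_ge0|exact: sqr_geometric_le].
have [l al ll] := cvg_series_half ab.
suff -> : psum c (w + h) - psum c w - h * psum (pderiv c) w = l.
  by apply: le_trans ll _; rewrite le_eqVlt; apply/orP; left; apply/eqP; ring.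
apply: (cvg_unique _ _ al); first exact: norm_hausdorff.
have -> : series a = (series (fun k => c k * (w + h) ^+ k)
     - series (fun k => c k * w ^+ k))
     - (fun n => h * series (fun k => c k * (k%:R * w ^+ k.-1)) n).
  apply/funext => n; rewrite /series /= !fctE mulr_sumr -!sumrB.
  by apply: eq_bigr => k _; rewrite /a; ring.
apply: cvgB; first by apply: cvgB; apply: (psum_cvg cM); exact: le_trans pr2.
apply: cvgM; first exact: cvg_cst.
rewrite -cvg_shiftS /=.
have -> : (fun n => series (fun k => c k * (k%:R * w ^+ k.-1)) n.+1)
       = series (fun k => pderiv c k * w ^+ k).
  apply/funext => n; rewrite /series /= big_nat_recl// mul0r mulr0 add0r.
  by apply: eq_bigr => k _; rewrite /pderiv /=; ring.
by apply: (psum_cvg (growth_pderiv cM)); exact: le_trans pr22.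
Qed.

(** A quadratic estimate of the increment gives the derivative without exchanging
    limits. *)
Lemma is_derive_quadratic (K : numFieldType) (f : K -> K) (w d b s : K) :
  0 < s -> (forall h, `|h| < s -> `|f (w + h) - f w - h * d| <= b * `|h| ^+ 2) ->
  is_derive w 1 f d.
Proof.
move=> s0 fb.
have b0 : 0 <= b.
  have := fb (s / 2); rewrite ger0_norm ?divr_ge0 ?(ltW s0)// ltr_pdivrMr// ltr_pMr// ltr1n.
  move=> /(_ isT) /(le_trans (normr_ge0 _)).
  by rewrite pmulr_lge0// exprn_gt0 ?divr_gt0.
have lim_d : h^-1 *: ((f \o shift w) (h *: 1) - f w) @[h --> 0^'] --> d.
  apply/cvgrPdist_lt => e e0.
  near=> h.
  have h0 : h != 0 by near: h; exact: nbhs_dnbhs_neq.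
  have hs : `|h| < s.
    near: h; apply: dnbhs0_lt; exact: s0.
  have he : `|h| < e / (b + 1).
    by near: h; apply: dnbhs0_lt; rewrite divr_gt0// ltr_wpDl.
  rewrite /= [h *: 1]mulr1 [h + w]addrC distrC -[_ *: _]/(_ * _).
  rewrite [X in `|X|](_ : _ = h^-1 * (f (w + h) - f w - h * d)); last first.
    by rewrite [RHS]mulrBr [h^-1 * (h * d)]mulrA mulVf// mul1r.
  rewrite normrM normfV mulrC ltr_pdivrMr ?normr_gt0//.
  apply: le_lt_trans (fb _ hs) _; rewrite expr2 mulrA ltr_pM2r ?normr_gt0//.
  move: he; rewrite ltr_pdivlMr ?ltr_wpDl// mulrC; apply: le_lt_trans.
  by rewrite ler_wpM2r// lerDl.
by apply: DeriveDef; [apply/cvg_ex; exists d|apply/cvg_lim].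
Unshelve. all: by end_near. Qed.

Lemma psum_is_derive (R : realType) (c : nat -> C R) (r M w : C R) :
  growth c r M -> `|w| < r / 4 -> is_derive w 1 (psum c) (psum (pderiv c) w).
Proof.
move=> cM wr.
apply: (@is_derive_quadratic _ _ _ _ (4 * (M / (r / 4) ^+ 2)) (r / 4 - `|w|)).
  by rewrite subr_gt0.
move=> h hs; apply: psum_taylor => //; first exact: ltW.
by rewrite (le_trans (ler_normD _ _))// -lerBrDl ltW.
Qed.

Lemma growth_near (R : realType) (c : nat -> C R) (f : C R -> C R) :
  (\forall w \near 0^', series (fun k => c k * w ^+ k) @ \oo --> f w) ->
  exists r M, growth c r M.
Proof.
move=> cf.
have [w [w0 cw]] : exists w : C R, w != 0 /\ series (fun k => c k * w ^+ k) @ \oo --> f w.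
  apply: (@filter_ex _ (0 : C R)^'); near=> w; split; last by near: w.
  by near: w; exact: nbhs_dnbhs_neq.
have [M cM] := cvg_growth w0 cw.
by exists `|w|, M.
Unshelve. all: by end_near. Qed.

Lemma psum_continuous (R : realType) (c : nat -> C R) (r M w : C R) :
  growth c r M -> `|w| < r / 4 -> {for w, continuous (psum c)}.
Proof.
move=> cM wr; apply: differentiable_continuous; apply/derivable1_diffP.
by have [] := psum_is_derive cM wr.
Qed.

Lemma near_psum (R : realType) (c : nat -> C R) (f : C R -> C R) :
  (\forall w \near 0^', series (fun k => c k * w ^+ k) @ \oo --> f w) ->
  \forall w \near 0^', f w = psum c w.
Proof.
by apply: filterS => w cw; apply/esym/cvg_lim.
Qed.

(** The sum of the series extends continuously to [0], even if the convergence is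
    assumed in a punctured neighbourhood only. *)
Lemma psum_cvg0 (R : realType) (c : nat -> C R) (f : C R -> C R) :
  (\forall w \near 0^', series (fun k => c k * w ^+ k) @ \oo --> f w) ->
  f w @[w --> 0^'] --> c 0%N.
Proof.
move=> cf; have [r [M cM]] := growth_near cf.
have r4 : `|0 : C R| < r / 4 by rewrite normr0 divr_gt0// cM.1.
have := psum_continuous cM r4; rewrite continuous_withinNx psum0.
by apply: cvg_trans; apply: near_eq_cvg; apply: filterS (near_psum cf) => w ->.
Qed.

Lemma cvg_series_shift (R : realType) (c : nat -> C R) (w l : C R) :
  w != 0 -> series (fun k => c k * w ^+ k) @ \oo --> l ->
  series (fun k => c k.+1 * w ^+ k) @ \oo --> w^-1 * (l - c 0%N).
Proof.
move=> w0; rewrite -cvg_shiftS => cl.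
have -> : series (fun k => c k.+1 * w ^+ k) =
    (fun n => w^-1 * (series (fun k => c k * w ^+ k) n.+1 - c 0%N)).
  apply/funext => n; rewrite /series /= big_nat_recl// expr0 mulr1 addrC addKr.
  rewrite mulr_sumr; apply: eq_bigr => k _.
  by rewrite exprS mulrCA mulKf.
apply: cvgM; first exact: cvg_cst.
by apply: cvgB; [exact: cl|exact: cvg_cst].
Qed.

(** The constant coefficient is the limit at [0]; divide by [w] and repeat. *)
Lemma pseries_eq0 (R : realType) (c : nat -> C R) :
  (\forall w \near 0^', series (fun k => c k * w ^+ k) @ \oo --> (0 : C R)) ->
  forall k, c k = 0.
Proof.
move=> c0 k; elim: k c c0 => [|k IH] c c0.
  have := psum_cvg0 c0; move/(@cvg_unique _ (@norm_hausdorff _ _)); apply.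
  exact: cvg_cst.
apply: (IH (fun k => c k.+1)).
have c00 : c 0%N = 0.
  have := psum_cvg0 c0; move/(@cvg_unique _ (@norm_hausdorff _ _)); apply.
  exact: cvg_cst.
near=> w.
rewrite (_ : 0 = w^-1 * (0 - c 0%N)); last by rewrite c00 subrr mulr0.
apply: cvg_series_shift; last by near: w.
by near: w; exact: nbhs_dnbhs_neq.
Unshelve. all: by end_near. Qed.

Lemma cvg_horner (R : realType) (s : {poly C R}) (t : C R) :
  series (fun k => s`_k * t ^+ k) @ \oo --> s.[t].
Proof.
apply: cvg_near_cst; near=> n; rewrite /series /= big_mkord.
rewrite -(@horner_coef_wide _ n) //; near: n; exact: nbhs_infty_ge.
Unshelve. all: by end_near. Qed.

(** One factor is a polynomial, so that this is a finite combination of shifted series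
    and no absolute convergence is required. *)
Lemma cvg_cauchy_product (R : realType) (p : {poly C R}) (z : nat -> C R) (t l : C R) :
  series (fun k => z k * t ^+ k) @ \oo --> l ->
  series (fun r => (\sum_(k < r.+1) p`_k * z (r - k)%N) * t ^+ r) @ \oo --> p.[t] * l.
Proof.
move=> zl; elim/poly_ind: p => [|p a IH].
  rewrite horner0 mul0r; apply: cvg_near_cst; near=> n.
  rewrite /series /= big1// => r _; rewrite big1 ?mul0r// => k _.
  by rewrite coef0 mul0r.
rewrite hornerMXaddC mulrDl [p.[t] * t * l + _]addrC.
set F := fun r => (\sum_(k < r.+1) p`_k * z (r - k)%N) * t ^+ r.
set G := fun r => (\sum_(k < r.+1) (p * 'X + a%:P)`_k * z (r - k)%N) * t ^+ r.
have GF n : series G n.+1 = a * series (fun k => z k * t ^+ k) n.+1 + t * series F n.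
  rewrite /series /= !mulr_sumr /G.
  under eq_bigr do rewrite big_ord_recl coefD coefMX coefC/= subn0 add0r mulrDl -mulrA.
  rewrite big_split /=; congr (_ + _).
  rewrite big_nat_recl// big_ord0 mul0r add0r; apply: eq_bigr => r _.
  rewrite /F mulrCA -exprS; congr (_ * _); apply: eq_bigr => k _.
  by rewrite coefD coefMX coefC/= addr0.
suff : series G n.+1 @[n --> \oo] --> a * l + p.[t] * t * l by rewrite cvg_shiftS.
rewrite (funext GF).
apply: cvgD.
  apply: cvgM; first exact: cvg_cst.
  by move: zl; rewrite -cvg_shiftS; apply.
rewrite [p.[t] * t]mulrC -mulrA.
by apply: cvgM; [exact: cvg_cst|exact: IH].
Unshelve. all: by end_near. Qed.

(** The tool for splitting an identity on the line [t |-> (x, t v)] into homogeneous parts. *)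
Lemma pseries_mul_poly (R : realType) (p s : {poly C R}) (z : nat -> C R) (f : C R -> C R) :
  (\forall t \near 0^', series (fun k => z k * t ^+ k) @ \oo --> f t) ->
  (\forall t \near 0^', p.[t] * f t = s.[t]) ->
  forall r, s`_r = \sum_(k < r.+1) p`_k * z (r - k)%N.
Proof.
move=> zf pf r; apply/eqP; rewrite -subr_eq0; apply/eqP; move: r.
apply: pseries_eq0; near=> t.
rewrite (_ : series _ = series (fun k => s`_k * t ^+ k) -
   series (fun r => (\sum_(k < r.+1) p`_k * z (r - k)%N) * t ^+ r)); last first.
  apply/funext => n; rewrite /series /= !fctE -sumrB.
  by apply: eq_bigr => k _; rewrite mulrBl.
have pt : p.[t] * f t = s.[t] by near: t; exact: pf.
have zt : series (fun k => z k * t ^+ k) @ \oo --> f t by near: t; exact: zf.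
have := cvgB (@cvg_horner _ s t) (@cvg_cauchy_product _ p z t _ zt).
by rewrite pt subrr; apply.
Unshelve. all: by end_near. Qed.

(** * Meromorphic functions *)

Lemma near_differentiable (R : realType) (f g : C R -> C R) (a : C R) :
  (\forall z \near a, f z = g z) -> differentiable f a -> differentiable g a.
Proof.
move=> fg /derivable1_diffP fa; apply/derivable1_diffP.
by apply: near_eq_derivable fa => //; rewrite oner_neq0.
Qed.

Lemma differentiable_expr (K : numFieldType) (V : normedModType K) (f : V -> K)
    n (x : V) :
  differentiable f x -> differentiable (fun z => f z ^+ n) x.
Proof.
case: n => [|n] fx; first exact: differentiable_cst.
by have := differentiableX n fx; rewrite exprfctE.
Qed.

Lemma near_neq0 (K : numFieldType) (w : K) : w != 0 -> \forall z \near w, z != 0.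
Proof. exact: (@cvgr_neq0 _ _ _ (nbhs w) _ id w cvg_id). Qed.

Lemma near_norm_lt (K : numFieldType) (w s : K) :
  `|w| < s -> \forall z \near w, `|z| < s.
Proof. exact: (@cvgr_norm_lt _ _ _ (nbhs w) _ id w cvg_id). Qed.

(** A coordinate vanishing at [p], finite or not, so that one proof serves both charts. *)
Definition chart_point (R : realType) (p : CP1 R) (w : C R) : C R :=
  if p is Some a then a + w else w^-1.

Definition chart_coord (R : realType) (p : CP1 R) (x : C R) : C R :=
  if p is Some a then x - a else x^-1.

Lemma chart_pointK (R : realType) (p : CP1 R) :
  cancel (@chart_point R p) (@chart_coord R p).
Proof. by case: p => [a|] w /=; rewrite ?invrK// addrC addKr. Qed.

Lemma in_chartE (R : realType) (p : CP1 R) (f : C R -> C R) (w : C R) :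
  in_chart p f w = f (chart_point p w).
Proof. by case: p. Qed.

Lemma in_chart_coord (R : realType) (p : CP1 R) (f : C R -> C R) :
  f = in_chart p f \o chart_coord p.
Proof. by apply/funext; case: p => [a|] x /=; rewrite ?invrK// addrC subrK. Qed.

Lemma differentiable_chart_coord (R : realType) (p : CP1 R) (w : C R) :
  w != 0 -> differentiable (@chart_coord R p) (chart_point p w).
Proof.
case: p => [a|] w0; last by apply: differentiable_Rinv; rewrite invr_neq0.
by apply: differentiableB; [exact/derivable1_diffP|exact: differentiable_cst].
Qed.

(** Near [p] the function is [w ^- m] times a power series in the coordinate [w], which is
    differentiable away from [w = 0]. *)
Lemma meromorphic_analytic (R : realType) (U : set (CP1 R)) (f : C R -> C R) p :
  meromorphic U f -> U p ->
  \forall w \near (0 : C R)^', analytic_at f (chart_point p w).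
Proof.
move=> fU /fU [m [c cf]].
have [r [M cM]] := growth_near cf.
have r0 : 0 < r / 4 by rewrite divr_gt0// cM.1.
have fc : \forall w \near (0 : C R)^', w ^+ m * in_chart p f w = psum c w.
  exact: near_psum cf.
have [s /= s0 sf] : exists2 s : C R, 0 < s & forall w : C R, w != 0 -> `|w| < s ->
    w ^+ m * in_chart p f w = psum c w.
  move: fc => /nbhs_ballP [s /= s0 sf]; exists s => // w w0 ws; apply: sf => //.
  by rewrite -ball_normE /= sub0r normrN.
have dg (w : C R) : w != 0 -> `|w| < s -> `|w| < r / 4 -> differentiable (in_chart p f) w.
  move=> w0 ws wr.
  have nw0 : \forall z \near w, z != 0.
    exact: near_neq0.
  apply: (@near_differentiable _ (fun z => psum c z * (z ^+ m)^-1)).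
    near=> z.
    have z0 : z != 0 by near: z.
    have zs : `|z| < s by near: z; exact: near_norm_lt.
    by rewrite -sf// mulrC mulKf// expf_neq0.
  apply: differentiableM.
    by apply/derivable1_diffP; have [] := psum_is_derive cM wr.
  apply: differentiableV; last by rewrite expf_neq0.
  exact: (@differentiable_expr _ _ id).
near=> w.
have w0 : w != 0.
  by near: w; exact: (@nbhs_dnbhs_neq _ (0 : C R)).
have ws : `|w| < s by near: w; exact: (@dnbhs0_lt _ (C R) _ s0).
have wr : `|w| < r / 4 by near: w; exact: (@dnbhs0_lt _ (C R) _ r0).
have cK : {for chart_point p w, continuous (@chart_coord R p)}.
  exact/differentiable_continuous/differentiable_chart_coord.
have cc (P : set (C R)) : (\forall z \near (w : C R), P z) ->
    \forall x \near chart_point p w, P (chart_coord p x).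
  by move=> Pw; apply: cK; rewrite chart_pointK.
near=> x.
rewrite (in_chart_coord p f).
have x0 : chart_coord p x != 0.
  near: x; apply: (cc (fun z => z != 0)).
  exact: near_neq0.
apply: differentiable_comp.
  rewrite (_ : x = chart_point p (chart_coord p x)); last first.
    by case: {+}p => [a|] /=; rewrite ?invrK// addrC subrK.
  exact: differentiable_chart_coord.
apply: dg => //.
  by near: x; apply: (cc (fun z => `|z| < s)); exact: near_norm_lt.
by near: x; apply: (cc (fun z => `|z| < r / 4)); exact: near_norm_lt.
Unshelve. all: by end_near. Qed.

Lemma cvg_dnbhs_unique (R : realType) (f : C R -> C R) (x l l' : C R) :
  f w @[w --> x^'] --> l -> f w @[w --> x^'] --> l' -> l = l'.
Proof. by move=> fl fl'; move: fl fl'; apply: cvg_unique; exact: norm_hausdorff. Qed.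

Lemma continuous_subr (K : numFieldType) (a x : K) :
  {for x, continuous (fun w => w - a)}.
Proof.
apply: differentiable_continuous; apply: differentiableB; first exact: ex_diff.
exact: differentiable_cst.
Qed.

Lemma near_eq_continuous (T T' : topologicalType) (f g : T -> T') (x : T) :
  (\forall w \near x, f w = g w) ->
  {for x, continuous g} -> {for x, continuous f}.
Proof.
move=> fg gc P /=; rewrite (nbhs_singleton fg) => /gc.
by apply: filterS2 fg => w /= ->.
Qed.

(** A pole of order [m] that is removable is absent from the Laurent series: the
    constant coefficient is the limit of [w ^+ m * g w] at [0], so it vanishes as long
    as [m > 0]. *)
Lemma pseries_divX (R : realType) (g : C R -> C R) (m : nat) (c : nat -> C R) :
  {for 0, continuous g} ->
  (\forall w \near 0^', series (fun k => c k * w ^+ k) @ \oo --> w ^+ m * g w) ->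
  exists c' : nat -> C R,
    \forall w \near 0^', series (fun k => c' k * w ^+ k) @ \oo --> g w.
Proof.
move=> g0; elim: m c => [|m IH] c cg.
  by exists c; apply: filterS cg => w; rewrite expr0 mul1r; apply.
apply: (IH (fun k => c k.+1)).
have c00 : c 0%N = 0.
  have wm : {for (0 : C R), continuous (fun w : C R => w ^+ m.+1)}.
    by apply: differentiable_continuous; exact: (@differentiable_expr _ _ id).
  have wg : w ^+ m.+1 * g w @[w --> (0 : C R)^'] --> (0 : C R) ^+ m.+1 * g 0.
    exact: cvgM ((continuous_withinNx _ _).1 wm) ((continuous_withinNx _ _).1 g0).
  rewrite expr0n mul0r in wg.
  exact: cvg_dnbhs_unique (psum_cvg0 cg) wg.
near=> w.
have w0 : w != 0 by near: w; exact: (@nbhs_dnbhs_neq _ (0 : C R)).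
have -> : w ^+ m * g w = w^-1 * (w ^+ m.+1 * g w - c 0%N).
  by rewrite c00 subr0 exprS -mulrA mulKf.
apply: cvg_series_shift w0 _.
by near: w; exact: cg.
Unshelve. all: by end_near. Qed.

(** A removable singularity of the derivative: near [a] the function is a
    power series in [x - a], and so is its derivative. *)
Lemma derive1_meromorphic_continuous (R : realType) (U : set (CP1 R))
    (f : C R -> C R) (a : C R) :
  meromorphic U f -> U (Some a) -> analytic_at f a -> {for a, continuous (derive1 f)}.
Proof.
move=> fU /fU [m [c cf]] fa.
pose g w := f (a + w).
have g0 : {for 0, continuous g}.
  apply: continuous_comp; first by apply: continuousD; [exact: cst_continuous|].
  rewrite addr0; apply: differentiable_continuous; exact: nbhs_singleton fa.
have [c' c'g] := pseries_divX g0 cf.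
have [r [M c'M]] := growth_near c'g.
have r0 : 0 < r by exact: c'M.1.
have g00 : g 0 = psum c' 0.
  rewrite psum0.
  exact: cvg_dnbhs_unique ((continuous_withinNx _ _).1 g0) (psum_cvg0 c'g).
have gps : \forall w \near (0 : C R), g w = psum c' w.
  have : nbhs (0 : C R) (fun w => w != 0 -> g w = psum c' w) by exact: near_psum c'g.
  by apply: filterS => w gw; have [->|/gw] := eqVneq w 0.
have dg : \forall w \near (0 : C R), derive1 g w = psum (pderiv c') w.
  have near_r : \forall w \near (0 : C R), `|w| < r / 4.
    by apply: near_norm_lt; rewrite normr0 divr_gt0.
  apply: filterS2 near_r (nbhs_interior gps) => w wr gw; rewrite derive1E (near_eq_derive _ gw).
  exact: (@derive_val _ _ _ _ _ _ _ (psum_is_derive c'M wr)).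
have dfg : derive1 f = derive1 g \o (fun x => x - a).
  apply/funext => x; rewrite /derive1 /g /=.
  apply: (congr1 (fun F : C R -> C R => lim (F h @[h --> 0^']))); apply/funext => h.
  by rewrite addrCA !(addrC a) !subrK.
have gc : {for (0 : C R), continuous (psum (pderiv c'))}.
  by apply: (psum_continuous (growth_pderiv c'M)); rewrite normr0 !divr_gt0.
have g'c : {for (0 : C R), continuous (derive1 g)}.
  exact: near_eq_continuous dg gc.
rewrite dfg; apply: continuous_comp; first exact: continuous_subr.
by rewrite subrr; exact: g'c.
Qed.

Lemma near_dnbhs_neq (R : realType) (b : C R) : \forall w \near (0 : C R)^', w != b.
Proof.
have [->|b0] := eqVneq b 0; first exact: nbhs_dnbhs_neq.
apply: nbhs_dnbhs; have := @near_norm_lt _ (0 : C R) `|b|.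
rewrite normr0 normr_gt0 => /(_ b0); apply: filterS => w wb.
by apply: contraTneq wb => ->; rewrite ltxx.
Qed.

Lemma near_chart_neq (R : realType) (p : CP1 R) (b : C R) :
  \forall w \near (0 : C R)^', chart_point p w != b.
Proof.
apply: filterS (near_dnbhs_neq (chart_coord p b)) => w.
by apply: contraNneq => <-; rewrite chart_pointK.
Qed.

Lemma near_chart_horner (R : realType) (p : CP1 R) (q : {poly C R}) :
  q != 0 -> \forall w \near (0 : C R)^', q.[chart_point p w] != 0.
Proof.
move=> q0; have [rs ->] := closed_field_poly_normal q.
have : \forall w \near (0 : C R)^', chart_point p w \notin rs.
  elim: rs => [|b rs IH]; first exact: filterE.
  apply: filterS2 IH (near_chart_neq p b) => w wrs wb.
  by rewrite inE negb_or wb.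
apply: filterS => w wrs.
rewrite hornerZ mulf_neq0 ?lead_coef_eq0// -/(root _ _).
by rewrite root_prod_XsubC.
Qed.

Lemma open_affine_part (R : realType) (U : set (CP1 R)) :
  open U -> open (affine_part U).
Proof. by rewrite !openE => oU x /oU. Qed.

(** At infinity, the complement of [U] lies in a compact set [V] of finite points; every
    point of [V] has a neighbourhood that [w^-1] avoids for small [w], and
    compactness makes the choice of [w] uniform. *)
Lemma near_chart_affine (R : realType) (U : set (CP1 R)) (p : CP1 R) :
  open U -> U p -> \forall w \near (0 : C R)^', affine_part U (chart_point p w).
Proof.
rewrite openE => oU /oU; case: p => [a|] Up.
  apply: nbhs_dnbhs.
  have ca : {for (0 : C R), continuous (fun w => a + w)}.
    by apply: continuousD; [exact: cst_continuous|].
  by apply: ca; rewrite addr0.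
case: Up => V [cV _] VU.
have VN : \forall w \near (0 : C R)^', V `<=` (fun x => w^-1 <> x).
  move/compact_near_coveringP : cV; apply => x Vx.
  have x1 : 0 < (`|x| + 1)^-1 by rewrite invr_gt0 ltr_wpDl.
  exists ([set y | `|y| < `|x| + 1], [set w | w != 0 /\ `|w| < (`|x| + 1)^-1]) => /=.
    split; first by apply: near_norm_lt; rewrite ltrDl.
    have := @dnbhs0_lt _ (C R) _ x1.
    by apply: filterS2 (near_dnbhs_neq (0 : C R)) => w; split.
  move=> [y w] /= [yx [w0 wx]] wy; move: yx; rewrite -wy normfV => yx.
  have := ltr_pM _ _ yx wx; rewrite invr_ge0 normr_ge0 => /(_ isT isT).
  by rewrite mulVf ?normr_eq0// divff ?ltxx// gt_eqF// ltr_wpDl.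
apply: filterS VN => w Vw; apply: VU; left; exists w^-1 => //.
by move/Vw.
Qed.

(** * Polynomials in [y] with coefficients functions of [x] *)

(** Evaluation of functions, named so that it can carry a ring morphism structure. *)
Definition fun_at (R : realType) (x : C R) (c : C R -> C R) : C R := c x.

HB.instance Definition _ (R : realType) (x : C R) :=
  GRing.isAdditive.Build (C R -> C R) (C R) (fun_at x) (fun c d => erefl).
HB.instance Definition _ (R : realType) (x : C R) :=
  GRing.isMultiplicative.Build (C R -> C R) (C R) (fun_at x)
    ((fun c d => erefl), erefl).

Definition ev (R : realType) (n : nat) (q : phase R n) :
    {mpoly (C R -> C R)[n]} -> C R :=
  mmap (fun_at q.1) (fun j => q.2 0 j).

HB.instance Definition _ (R : realType) (n : nat) (q : phase R n) :=
  GRing.RMorphism.copy (@ev R n q) (mmap (fun_at q.1) (fun j => q.2 0 j)).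

Lemma evE (R : realType) (n : nat) (q : phase R n) z :
  ev q z = \sum_(m <- msupp z) z@_m q.1 * mmap1 (fun j => q.2 0 j) m.
Proof. by []. Qed.

Lemma evC (R : realType) (n : nat) (q : phase R n) (c : C R -> C R) :
  ev q c%:MP = c q.1.
Proof. exact: mmapC. Qed.

Lemma evX (R : realType) (n : nat) (q : phase R n) j : ev q 'X_j = q.2 0 j.
Proof. by rewrite /ev mmapX mmap1U. Qed.

Lemma evB (R : realType) (n : nat) (q : phase R n) :
  {morph @ev R n q : z z' / z - z'}.
Proof. exact: rmorphB. Qed.

Lemma evM (R : realType) (n : nat) (q : phase R n) :
  {morph @ev R n q : z z' / z * z'}.
Proof. exact: rmorphM. Qed.

Lemma ev_homog (R : realType) (n r : nat) (x t : C R) (v : 'rV[C R]_n)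
    (z : {mpoly (C R -> C R)[n]}) :
  z \is r.-homog -> ev (x, t *: v) z = t ^+ r * ev (x, v) z.
Proof.
move=> /dhomogP zr; rewrite !evE mulr_sumr /= big_seq [RHS]big_seq.
apply: eq_bigr => m /zr mr; rewrite mulrCA; congr (_ * _).
rewrite /mmap1 -mr /= mdegE -prodrXr -big_split /=.
by apply: eq_bigr => j _; rewrite mxE exprMn.
Qed.

(** Restriction to the line [t |-> (x, t *: v)], where [q = (x, v)]. *)
Definition line_poly (R : realType) (n : nat) (q : phase R n)
    (z : {mpoly (C R -> C R)[n]}) : {poly C R} :=
  \poly_(d < msize z) ev q (pihomog mdeg d z).

Lemma coef_line_poly (R : realType) (n : nat) (q : phase R n) z r :
  (line_poly q z)`_r = ev q (pihomog mdeg r z).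
Proof.
rewrite coef_poly; case: (ltnP r (msize z)) => // zr.
rewrite pihomogE big_seq_cond big_pred0 ?rmorph0// => m.
apply/negbTE; rewrite negb_and -implybE; apply/implyP => /msize_mdeg_lt mz.
by rewrite neq_ltn (leq_trans mz zr).
Qed.

Lemma horner_line_poly (R : realType) (n : nat) (x t : C R) (v : 'rV[C R]_n) z :
  (line_poly (x, v) z).[t] = ev (x, t *: v) z.
Proof.
have zE := @pihomog_partitionE n _ mdeg (msize z) z (leqnn _).
rewrite horner_poly [RHS](congr1 (ev (x, t *: v)) zE).
rewrite rmorph_sum /=; apply: eq_bigr => d _.
by rewrite (ev_homog _ _ _ (pihomogP _ _ _)) mulrC.
Qed.

Lemma ev0 (R : realType) (n : nat) (x : C R) (z : {mpoly (C R -> C R)[n]}) :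
  ev (x, 0) z = ev (x, 0) (pihomog mdeg 0 z).
Proof.
have := horner_line_poly x 0 (0 : 'rV_n) z.
by rewrite scaler0 horner_coef0 coef_line_poly => <-.
Qed.

(** Uniqueness of the expansion in base [b]. *)
Lemma digits_inj (b n : nat) (f g : 'I_n -> nat) :
  (forall i, f i < b)%N -> (forall i, g i < b)%N ->
  (\sum_i f i * b ^ i = \sum_i g i * b ^ i)%N -> f =1 g.
Proof.
elim: n f g => [|n IH] f g fb gb; first by move=> _ [].
rewrite !big_ord_recl !expn0 !muln1.
have E (h : 'I_n.+1 -> nat) : (\sum_(i < n) h (lift ord0 i) * b ^ lift ord0 i =
    (\sum_(i < n) h (lift ord0 i) * b ^ i) * b)%N.
  by rewrite big_distrl /=; apply: eq_bigr => i _; rewrite /bump /= add1n expnSr mulnA.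
rewrite !E => H.
have f0 : f ord0 = g ord0.
  have := congr1 (modn^~ b) H.
  by rewrite ![(_ ord0 + _)%N]addnC !modnMDl !modn_small.
have b0 : (0 < b)%N by apply: leq_ltn_trans (fb ord0).
move: H; rewrite f0 => /addnI /eqP; rewrite eqn_pmul2r// => /eqP /IH fg i.
by case: (unliftP ord0 i) => [j ->|->//]; apply: fg.
Qed.

(** Kronecker's substitution [y_j = t ^ (b ^ j)] sends the monomials of [z] to distinct
    powers of [t], which reduces the statement to one variable. *)
Lemma ev_eq0 (R : realType) (n : nat) (x : C R) (z : {mpoly (C R -> C R)[n]}) :
  (forall v, ev (x, v) z = 0) -> forall m, z@_m x = 0.
Proof.
move=> z0 m; pose b := msize z.
pose kr (m : 'X_{1..n}) := (\sum_i m i * b ^ i)%N.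
pose p : {poly C R} := \sum_(m <- msupp z) z@_m x *: 'X^(kr m).
have p0 : p = 0.
  apply/eqP; apply: contraT => /(near_chart_horner (Some 0)) pN.
  suff : \forall w \near (0 : C R)^', False by move/filter_ex => [].
  apply: filterS pN => w; rewrite /= add0r => /eqP; apply.
  rewrite -[RHS](z0 (\row_j (w ^+ (b ^ j)))) evE /p horner_sum.
  apply: eq_bigr => m' _; rewrite hornerZ hornerXn; congr (_ * _).
  rewrite /kr -prodrXr /mmap1; apply: eq_bigr => j _.
  by rewrite mxE -exprM mulnC.
case: (boolP (m \in msupp z)) => [mz|/memN_msupp_eq0 -> //].
have := congr1 (fun p : {poly C R} => p`_(kr m)) p0.
rewrite coef0 /p coef_sum (bigD1_seq m) ?msupp_uniq//= big_seq_cond big1 => [|m' /andP[m'z m'm]].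
  by rewrite addr0 coefZ coefXn eqxx mulr1.
rewrite coefZ coefXn; case: eqP => [krm|]; last by rewrite mulr0.
move: m'm => /eqP[]; apply/mnmP; apply: (@digits_inj b).
- move=> i; apply: leq_ltn_trans (msize_mdeg_lt m'z).
  by rewrite mdegE (bigD1 i)//= leq_addr.
- move=> i; apply: leq_ltn_trans (msize_mdeg_lt mz).
  by rewrite mdegE (bigD1 i)//= leq_addr.
- by rewrite -/(kr m') -/(kr m) krm.
Qed.

(** The closure properties that pass from coefficients to polynomials.  The constants
    include 1, and 0 - f gives opposites. *)
Record fun_ring (R : realType) (S : set (C R -> C R)) : Prop := FunRing {
  fr_const : forall c : C R, S (fun=> c);
  fr_sub : forall f g, S f -> S g -> S (fun x => f x - g x);
  fr_mul : forall f g, S f -> S g -> S (fun x => f x * g x)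
}.

Definition coefs_in (R : realType) (n : nat) (S : set (C R -> C R))
    (z : {mpoly (C R -> C R)[n]}) : Prop := forall m, S z@_m.

Section CoefsIn.
Context (R : realType) (n : nat) (S : set (C R -> C R)) (S_ring : fun_ring S).

Lemma fr_add f g : S f -> S g -> S (f + g).
Proof.
move=> Sf Sg; have : S (fun x => f x - (0 - g x)).
  by apply: fr_sub => //; apply: (fr_sub S_ring (fr_const S_ring 0)).
by congr (S _); apply/funext => x; rewrite sub0r opprK.
Qed.

Lemma fr_sum (I : Type) (r : seq I) (P : pred I) (F : I -> C R -> C R) :
  (forall i, P i -> S (F i)) -> S (\sum_(i <- r | P i) F i).
Proof.
move=> SF; elim/big_ind: _ => //; first exact: (fr_const S_ring 0).
exact: fr_add.
Qed.

Lemma coefs_inB z z' : coefs_in S z -> coefs_in S z' -> coefs_in (n := n) S (z - z').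
Proof. by move=> Sz Sz' m; rewrite mcoeffB; apply: (fr_sub S_ring). Qed.

Lemma coefs_inM z z' : coefs_in S z -> coefs_in S z' -> coefs_in (n := n) S (z * z').
Proof.
move=> Sz Sz' m; rewrite mcoeffM; apply: fr_sum => k _.
exact: (fr_mul S_ring).
Qed.

Lemma coefs_in_sum (I : Type) (r : seq I) (P : pred I) F :
  (forall i, P i -> coefs_in S (F i)) ->
  coefs_in (n := n) S (\sum_(i <- r | P i) F i).
Proof. by move=> SF m; rewrite raddf_sum; apply: fr_sum => i Pi; exact: SF. Qed.

Lemma fr_bool (b : bool) : S (b%:R : C R -> C R).
Proof. by case: b; [exact: (fr_const S_ring 1)|exact: (fr_const S_ring 0)]. Qed.

Lemma coefs_inC c : S c -> coefs_in (n := n) S c%:MP.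
Proof.
by move=> Sc m; rewrite mcoeffC; apply: (fr_mul S_ring) => //; exact: fr_bool.
Qed.

Lemma coefs_inXm m : coefs_in (n := n) S 'X_[m].
Proof. by move=> m'; rewrite mcoeffX; exact: fr_bool. Qed.

Lemma coefs_in_prod (I : Type) (r : seq I) (P : pred I) F :
  (forall i, P i -> coefs_in S (F i)) ->
  coefs_in (n := n) S (\prod_(i <- r | P i) F i).
Proof.
move=> SF; elim/big_ind: _ => //; last exact: coefs_inM.
by rewrite -[1]mpolyC1; apply: coefs_inC; exact: (fr_const S_ring 1).
Qed.

Lemma coefs_inX z k : coefs_in S z -> coefs_in (n := n) S (z ^+ k).
Proof.
move=> Sz; elim: k => [|k IH].
  by rewrite expr0 -[1]mpolyC1; apply: coefs_inC; exact: (fr_const S_ring 1).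
by rewrite exprS; apply: coefs_inM.
Qed.

Lemma coefs_in_pihomog d z : coefs_in S z -> coefs_in (n := n) S (pihomog mdeg d z).
Proof.
move=> Sz; rewrite pihomogE; apply: coefs_in_sum => m _.
by rewrite -mul_mpolyC; apply: coefs_inM; [exact: coefs_inC|exact: coefs_inXm].
Qed.

End CoefsIn.

(** The variable [x] moves from the indeterminates to the coefficients. *)
Definition lift_y (R : realType) (n : nat) (P : {mpoly (C R)[1 + n]}) :
    {mpoly (C R -> C R)[n]} :=
  \sum_(m <- msupp P) (fun=> P@_m)%:MP *
     \prod_(i < 1 + n) (match fintype.split i with
                        | inl _ => (@id (C R))%:MP
                        | inr j => 'X_j
                        end) ^+ m i.

Lemma ev_lift_y (R : realType) (n : nat) (q : phase R n) P :
  ev q (lift_y P) = P.@[coords q].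
Proof.
rewrite mevalE /lift_y rmorph_sum; apply: eq_bigr => m _ /=.
rewrite rmorphM /= evC rmorph_prod; congr (_ * _); apply: eq_bigr => i _ /=.
rewrite rmorphXn /= /coords mxE; congr (_ ^+ _).
case: fintype.split => [k|j]; last by rewrite evX.
by rewrite evC mxE (ord1 k) eqxx mulr1n.
Qed.

Lemma coefs_in_lift_y (R : realType) (n : nat) (S : set (C R -> C R))
    (P : {mpoly (C R)[1 + n]}) :
  fun_ring S -> S id -> coefs_in S (lift_y P).
Proof.
move=> SR Sid; apply: coefs_in_sum => // m _; apply: coefs_inM => //.
  by apply: coefs_inC => //; exact: (fr_const SR).
apply: coefs_in_prod => // i _; apply: coefs_inX => //.
by case: fintype.split => [k|j]; [exact: coefs_inC|exact: coefs_inXm].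
Qed.

(** * Rational functions *)

Lemma ratfun_value_unique (R : realType) (n : nat) (f : ratfun R n) (q : phase R n)
    (v v' : C R) :
  ratfun_value f q v -> ratfun_value f q v' -> v = v'.
Proof.
move=> [P [Q [Qq fPQ ->]]] [P' [Q' [Q'q fPQ' ->]]].
have nz (T : {mpoly (C R)[1 + n]}) : T.@[coords q] != 0 -> tofrac T != 0.
  by apply: contraNneq => /eqP; rewrite tofrac_eq0 => /eqP ->; rewrite meval0.
move: fPQ; rewrite fPQ' => /eqP; rewrite eqr_div ?nz// -!tofracM tofrac_eq => /eqP.
move=> /(congr1 (meval (coords q))); rewrite !mevalM => E.
by apply/eqP; rewrite eqr_div// E.
Qed.

Lemma ratfun_evalE (R : realType) (n : nat) (P Q : {mpoly (C R)[1 + n]}) (q : phase R n) :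
  Q.@[coords q] != 0 ->
  ratfun_eval (tofrac P / tofrac Q) q = P.@[coords q] / Q.@[coords q].
Proof.
move=> Qq; rewrite /ratfun_eval; case: xgetP => [v _ /= vE|/(_ (P.@[coords q] / Q.@[coords q]))].
  by apply: ratfun_value_unique vE _; exists P, Q.
by case; exists P, Q.
Qed.

(** Regularity of each component at one point suffices: the product of the
    denominators chosen there does not vanish there, and it is then used at all points. *)
Lemma common_denominator (R : realType) (n : nat) (Y : rat_vfield R n) (q : phase R n) :
  ~ polar_set Y q ->
  exists (Q P0 : {mpoly (C R)[1 + n]}) (P : 'I_n -> {mpoly (C R)[1 + n]}),
    [/\ Q.@[coords q] != 0, Y.1 = tofrac P0 / tofrac Q &
        forall i, Y.2 i = tofrac (P i) / tofrac Q].
Proof.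
move=> /not_orP[/contrapT [v0 [P0 [Q0 [Q0q YE _]]]] nY].
have /choice[PQ PQE] : forall i, exists PQ : {mpoly (C R)[1 + n]} * {mpoly (C R)[1 + n]},
    PQ.2.@[coords q] != 0 /\ Y.2 i = tofrac PQ.1 / tofrac PQ.2.
  move=> i; have /contrapT [v [P [Q [Qq YiE _]]]] : ~ ratfun_polar (Y.2 i) q.
    by move=> Yi; apply: nY; exists i.
  by exists (P, Q).
have nz (T : {mpoly (C R)[1 + n]}) : T.@[coords q] != 0 -> tofrac T != 0.
  by apply: contraNneq => /eqP; rewrite tofrac_eq0 => /eqP ->; rewrite meval0.
pose D := \prod_i (PQ i).2.
have Dq : D.@[coords q] != 0.
  by rewrite rmorph_prod; apply/prodf_neq0 => i _; have [] := PQE i.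
exists (Q0 * D), (P0 * D), (fun i => (PQ i).1 * (Q0 * \prod_(j | j != i) (PQ j).2)).
split; first by rewrite mevalM mulf_neq0.
  by rewrite YE !tofracM -mulf_div divff ?mulr1// nz.
move=> i; have [_ ->] := PQE i.
have -> : Q0 * D = (PQ i).2 * (Q0 * \prod_(j | j != i) (PQ j).2).
  by rewrite /D (bigD1 i)//; exact: mulrCA.
rewrite !tofracM -mulf_div divff ?mulr1// mulf_neq0 ?nz// rmorph_prod.
by apply/prodf_neq0 => j _; have [] := PQE j.
Qed.

(** * Differentiation on the phase space *)

Definition mon (R : realType) (n : nat) (m : 'X_{1..n}) (y : 'rV[C R]_n) : C R :=
  mmap1 (fun j => y 0 j) m.

Lemma differentiable_prod_seq (K : numFieldType) (V : normedModType K) (I : Type)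
    (r : seq I) (f : I -> V -> K) (x : V) :
  (forall i, differentiable (f i) x) ->
  differentiable (fun y => \prod_(i <- r) f i y) x.
Proof.
move=> fx; elim: r => [|i r IH].
  rewrite (_ : (fun _ => _) = cst 1); first exact: differentiable_cst.
  by apply/funext => y; rewrite big_nil.
rewrite (_ : (fun _ => _) = f i * (fun y => \prod_(i <- r) f i y)).
  exact: differentiableM.
by apply/funext => y; rewrite big_cons.
Qed.

Lemma differentiable_mon (R : realType) (n : nat) (m : 'X_{1..n}) (y : 'rV[C R]_n) :
  differentiable (@mon R n m) y.
Proof.
apply: differentiable_prod_seq => j.
by apply: differentiable_expr; exact: differentiable_coord.
Qed.

Lemma is_derive_sum_seq (K : numFieldType) (V W : normedModType K) (I : Type)
    (r : seq I) (f : I -> V -> W) (df : I -> W) (x v : V) :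
  (forall i, is_derive x v (f i) (df i)) ->
  is_derive x v (fun y => \sum_(i <- r) f i y) (\sum_(i <- r) df i).
Proof.
move=> fx; elim: r => [|i r IH].
  rewrite big_nil (_ : (fun _ => _) = cst 0); first exact: is_derive_cst.
  by apply/funext => y; rewrite big_nil.
rewrite big_cons (_ : (fun _ => _) = f i + (fun y => \sum_(i <- r) f i y)).
  exact: is_deriveD.
by apply/funext => y; rewrite big_cons.
Qed.

Lemma differentiable_sum_seq (K : numFieldType) (V W : normedModType K) (I : Type)
    (r : seq I) (f : I -> V -> W) (x : V) :
  (forall i, differentiable (f i) x) ->
  differentiable (fun y => \sum_(i <- r) f i y) x.
Proof.
move=> fx; elim: r => [|i r IH].
  rewrite (_ : (fun _ => _) = cst 0); first exact: differentiable_cst.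
  by apply/funext => y; rewrite big_nil.
rewrite (_ : (fun _ => _) = f i + (fun y => \sum_(i <- r) f i y)).
  exact: differentiableD.
by apply/funext => y; rewrite big_cons.
Qed.

Lemma continuous_linear_fst (K : numFieldType) (V W : normedModType K) :
  continuous (fst : V * W -> V).
Proof. by move=> x; exact: cvg_fst. Qed.

Lemma is_diff_fst (K : numFieldType) (V W : normedModType K) (x : V * W) :
  is_diff x (fst : V * W -> V) fst.
Proof.
apply: DiffDef; first exact/linear_differentiable/continuous_linear_fst.
exact/diff_lin/continuous_linear_fst.
Qed.

Lemma is_diff_snd (K : numFieldType) (V W : normedModType K) (x : V * W) :
  is_diff x (snd : V * W -> W) snd.
Proof.
have c : continuous (snd : V * W -> W) by move=> y; exact: cvg_snd.
apply: DiffDef; first exact/linear_differentiable.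
exact/diff_lin.
Qed.

Lemma is_derive_fst (R : realType) (n : nat) (c : C R -> C R) (q u : phase R n) :
  differentiable c q.1 ->
  is_derive q u (fun p : phase R n => c p.1) (u.1 * derive1 c q.1).
Proof.
move=> cq; have [d1 e1] := is_diff_fst q.
have dc := differentiable_comp d1 cq.
apply: DeriveDef; first exact: diff_derivable dc.
by rewrite (deriveE _ dc) (diff_comp d1 cq) /= e1 diff1E.
Qed.

Lemma is_derive_snd (R : realType) (n : nat) (c : 'rV[C R]_n -> C R) (q u : phase R n) :
  differentiable c q.2 ->
  is_derive q u (fun p : phase R n => c p.2) ('d c (q.2) u.2).
Proof.
move=> cq; have [d1 e1] := is_diff_snd q.
have dc := differentiable_comp d1 cq.
apply: DeriveDef; first exact: diff_derivable dc.
by rewrite (deriveE _ dc) (diff_comp d1 cq) /= e1.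
Qed.

Lemma ev_differentiable (R : realType) (n : nat) (q : phase R n)
    (z : {mpoly (C R -> C R)[n]}) :
  (forall m, differentiable z@_m q.1) -> differentiable (fun p => ev p z) q.
Proof.
move=> zq; apply: differentiable_sum_seq => m.
have [d1 _] := is_diff_fst q; have [d2 _] := is_diff_snd q.
apply: differentiableM; first exact: differentiable_comp d1 (zq m).
exact: differentiable_comp d2 (differentiable_mon m _).
Qed.

(** The two halves of the differential of [fun p => ev p z]: along [x], differentiating the
    coefficients, and along [y], differentiating the monomials.  Their separation
    shows that the derivative along a vector field is continuous in [x] as soon as the
    derivatives of the coefficients are. *)
Definition ev_dx (R : realType) (n : nat) (q : phase R n)
    (z : {mpoly (C R -> C R)[n]}) : C R :=
  \sum_(m <- msupp z) derive1 z@_m q.1 * mon m q.2.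

Definition ev_dy (R : realType) (n : nat) (q : phase R n)
    (z : {mpoly (C R -> C R)[n]}) (w : 'rV[C R]_n) : C R :=
  \sum_(m <- msupp z) z@_m q.1 * 'd (mon m) (q.2) w.

Lemma ev_is_derive (R : realType) (n : nat) (q u : phase R n)
    (z : {mpoly (C R -> C R)[n]}) :
  (forall m, differentiable z@_m q.1) ->
  is_derive q u (fun p => ev p z) (u.1 * ev_dx q z + ev_dy q z u.2).
Proof.
move=> zq; rewrite mulr_sumr -big_split /=; apply: is_derive_sum_seq => m.
have := is_deriveM (is_derive_fst u (zq m)) (is_derive_snd u (differentiable_mon m q.2)).
move=> H; apply: is_derive_eq H _; rewrite addrC; congr (_ + _).
rewrite -[LHS]/(mon m q.2 * (u.1 * derive1 z@_m q.1)).
by rewrite mulrC mulrA.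
Qed.

Lemma differentiable_component (R : realType) (n : nat) (f : vfield R n) (q : phase R n) i :
  differentiable f q -> differentiable (fun p => (f p).2 0 i) q.
Proof.
move=> fq; have [d2 _] := is_diff_snd (f q).
have d3 := differentiable_comp fq d2.
exact: differentiable_comp d3 (@differentiable_coord _ _ _ (f q).2 0 i).
Qed.

Lemma differentiable_component1 (R : realType) (n : nat) (f : vfield R n) (q : phase R n) :
  differentiable f q -> differentiable (fun p => (f p).1) q.
Proof.
by move=> fq; have [d1 _] := is_diff_fst (f q); exact: differentiable_comp fq d1.
Qed.

Lemma derive_component1 (R : realType) (n : nat) (f : vfield R n) (q u : phase R n) :
  differentiable f q -> ('D_u f q).1 = 'D_u (fun p => (f p).1) q.
Proof.
move=> fq; have [d1 e1] := is_diff_fst (f q).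
rewrite (deriveE _ fq) (deriveE _ (differentiable_component1 fq)).
by rewrite (diff_comp fq d1) /= e1.
Qed.

Lemma derive_component (R : realType) (n : nat) (f : vfield R n) (q u : phase R n) i :
  differentiable f q -> ('D_u f q).2 0 i = 'D_u (fun p => (f p).2 0 i) q.
Proof.
move=> fq; have [d2 e2] := is_diff_snd (f q).
have d3 := differentiable_comp fq d2.
have d4 := @differentiable_coord (C R) _ _ (f q).2 0 i.
rewrite (deriveE _ fq) (deriveE _ (differentiable_component i fq)).
rewrite (diff_comp d3 d4) /= (diff_comp fq d2) /= e2.
have lc : linear (fun N : 'rV[C R]_n => N 0 i : C R) by move=> a M N; rewrite !mxE.
pose L := GRing.isLinear.Build _ _ _ _ (fun N : 'rV[C R]_n => N 0 i : C R) lc.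
pose f0 : {linear 'rV[C R]_n -> C R} := HB.pack (fun N : 'rV[C R]_n => N 0 i : C R) L.
by rewrite (@diff_lin _ _ _ f0) //; exact: coord_continuous.
Qed.

Lemma differentiable_phase (R : realType) (n : nat) (f : vfield R n) (q : phase R n) :
  differentiable (fun p => (f p).1) q ->
  (forall i, differentiable (fun p => (f p).2 0 i) q) -> differentiable f q.
Proof.
move=> f1 f2.
have -> : f = fun p => ((f p).1, (\sum_(i <- index_enum 'I_n) (f p).2 0 i *: delta_mx 0 i)).
  by apply/funext => p; rewrite {1}[f p]surjective_pairing {1}[(f p).2]row_sum_delta.
apply: differentiable_pair => //; apply: differentiable_sum_seq => i.
exact: differentiableZl.
Qed.

(** The system is linear in [y], so its vector field at [(x, t *: v)] is [(1, t *: w)] if it is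
    [(1, w)] at [(x, v)]: derivation along it preserves the degree in [y].  Homogeneity
    already identifies the difference quotients. *)
Lemma derive_homog (R : realType) (n r : nat) (f : phase R n -> C R) (x t : C R)
    (v w : 'rV[C R]_n) :
  (forall x v, f (x, t *: v) = t ^+ r * f (x, v)) ->
  derivable f (x, v) (1, w) ->
  is_derive (x, t *: v) (1, t *: w) f (t ^+ r * 'D_(1, w) f (x, v)).
Proof.
move=> ft fv.
have E (h : C R) : h^-1 *: ((f \o shift (x, t *: v)) (h *: (1, t *: w)) - f (x, t *: v))
   = t ^+ r * (h^-1 *: ((f \o shift (x, v)) (h *: (1, w)) - f (x, v))).
  rewrite /=.
  have -> : h *: (1, t *: w) + (x, t *: v) = (h *: 1 + x, t *: (h *: w + v)).
    by congr (_, _); rewrite /= scalerDr !scalerA mulrC.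
  rewrite !ft -mulrBr -[_ *: _]/(_ * _) mulrCA; congr (_ * _).
have L : h^-1 *: ((f \o shift (x, t *: v)) (h *: (1, t *: w)) - f (x, t *: v)) @[h --> 0^']
    --> t ^+ r * 'D_(1, w) f (x, v).
  by rewrite (funext E); apply: cvgM fv; exact: cvg_cst.
by apply: DeriveDef; [apply/cvg_ex; eexists; exact: L|exact: cvg_lim L].
Qed.

(** Used to see that a polynomial not vanishing at one point of a line has isolated zeros
    on this line. *)
Lemma horner_mmap (R : realType) (k : nat) (P : {mpoly (C R)[k]}) (h : 'I_k -> {poly C R})
    (t : C R) :
  (mmap polyC h P).[t] = P.@[fun i => (h i).[t]].
Proof.
rewrite mevalE /mmap horner_sum; apply: eq_bigr => m _.
rewrite hornerM hornerC horner_prod; congr (_ * _).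
by apply: eq_bigr => i _; rewrite horner_exp.
Qed.

Lemma continuous_component (R : realType) (n : nat) i :
  continuous (fun p : phase R n => p.2 0 i).
Proof.
move=> p; apply: (@continuous_comp _ _ _ snd (fun y : 'rV[C R]_n => y 0 i)).
  exact: cvg_snd.
exact: coord_continuous.
Qed.

Lemma is_derive_quot (K : numFieldType) (V : normedModType K) (f g : V -> K)
    (df dg : K) (x v : V) :
  is_derive x v f df -> is_derive x v g dg -> g x != 0 ->
  is_derive x v (fun y => f y / g y) ((df * g x - f x * dg) / g x ^+ 2).
Proof.
move=> fx gx g0.
have gVx : is_derive x v (fun y => (g y)^-1) (- (g x) ^- 2 *: dg).
  apply: DeriveDef; first by apply: derivableV => //; exact: ex_derive.
  by rewrite deriveV ?derive_val//; exact: ex_derive.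
apply: is_derive_eq (is_deriveM fx gVx) _.
rewrite -[_ *: _]/(_ * _) -[_ *: df]/(_ * df) -[_ *: dg]/(_ * dg).
by field.
Qed.

Lemma is_derive_coord (R : realType) (n : nat) (q u : phase R n) j :
  is_derive q u (fun p : phase R n => p.2 0 j) (u.2 0 j).
Proof.
have idq : differentiable (id : vfield R n) q by exact: ex_diff.
apply: DeriveDef; first exact/diff_derivable/(differentiable_component j idq).
by rewrite -(derive_component u j idq) derive_id.
Qed.

(** With [D] the derivative along X, the hypothesis is the [y_i]-component of
    [Y, X] = - (D eta) X, where eta = [p0 / q], V_i = [p / q], [f] is the component of X
    and the derivative of [f] along Y is [p0 / q * a + sp / q] (for X itself it is
    [a + sf]).  The conclusion is the same component of q^2 [W, X] = 0. *)
Lemma symmetry_algebra (K : fieldType) (p0 p q f a sp sf dp0 dp dq : K) : q != 0 ->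
  (p0 / q * a + sp / q) - (dp * q - p * dq) / q ^+ 2 =
     - ((dp0 * q - p0 * dq) / q ^+ 2) * f ->
  (dp - (dp0 * f + p0 * (a + sf))) * q - (p - p0 * f) * dq = q * (sp - p0 * sf).
Proof.
move=> q0 E; have : ((p0 / q * a + sp / q) - (dp * q - p * dq) / q ^+ 2) * q ^+ 2 =
     - ((dp0 * q - p0 * dq) / q ^+ 2) * f * q ^+ 2 by rewrite E.
have -> : ((p0 / q * a + sp / q) - (dp * q - p * dq) / q ^+ 2) * q ^+ 2 =
   p0 * a * q + sp * q - (dp * q - p * dq) by field.
have -> : - ((dp0 * q - p0 * dq) / q ^+ 2) * f * q ^+ 2 = - (dp0 * q - p0 * dq) * f.
  by field.
move=> E'; apply/eqP; rewrite -subr_eq0; apply/eqP.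
rewrite [LHS](_ : _ = - (p0 * a * q + sp * q - (dp * q - p * dq) +
   (dp0 * q - p0 * dq) * f)); last by ring.
by rewrite E' mulNr addNr oppr0.
Qed.

Lemma quotient_rule (K : fieldType) (q w nn dn dq s : K) : q != 0 ->
  q * w = nn -> dn * q - nn * dq = q * s -> dq * w = dn - s.
Proof.
move=> q0 e3 e4; apply: (mulfI q0); rewrite mulrBr -e4 -e3; ring.
Qed.

(** All products are convolutions.  By Leibniz's rule the derivative of [a z] is
    [a dz + z da]; when it exceeds [sigma = a y] by [da z] only, [a (dz - y)] vanishes. *)
Lemma convolution_cancel (K : comRingType) r (a da z dz y : nat -> K) (sigma : K) :
  \sum_(k < r.+1) (a k * dz (r - k)%N + z (r - k)%N * da k) - sigma
    = \sum_(k < r.+1) da k * z (r - k)%N ->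
  sigma = \sum_(k < r.+1) a k * y (r - k)%N ->
  \sum_(k < r.+1) a k * (dz (r - k)%N - y (r - k)%N) = 0.
Proof.
rewrite big_split /= => + sigmaE.
have -> : \sum_(k < r.+1) z (r - k)%N * da k = \sum_(k < r.+1) da k * z (r - k)%N.
  by apply: eq_bigr => k _; rewrite mulrC.
rewrite addrAC -[RHS]add0r => /addIr E.
under eq_bigr do rewrite mulrBr.
by rewrite sumrB -sigmaE.
Qed.

Lemma continuous_sum_seq (K : numFieldType) (T : topologicalType) (I : Type)
    (r : seq I) (f : I -> T -> K) (x : T) :
  (forall i, {for x, continuous (f i)}) ->
  {for x, continuous (fun y => \sum_(i <- r) f i y)}.
Proof.
move=> fx; elim: r => [|i r IH].
  rewrite (_ : (fun _ => _) = cst 0); first exact: cst_continuous.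
  by apply/funext => y; rewrite big_nil.
rewrite (_ : (fun _ => _) = (fun y => f i y + \sum_(j <- r) f j y)); last first.
  by apply/funext => y; rewrite big_cons.
exact: cvgD (fx i) IH.
Qed.

Lemma continuous_addl (K : numFieldType) (a x : K) :
  {for x, continuous (fun w => a + w)}.
Proof.
apply: differentiable_continuous; apply: differentiableD; last exact: ex_diff.
exact: differentiable_cst.
Qed.

Lemma near_dnbhs_eq0 (R : realType) (h : C R -> C R) :
  {for 0, continuous h} -> (\forall w \near (0 : C R)^', h w = 0) -> h 0 = 0.
Proof.
move=> h0 hn; have hc := (continuous_withinNx _ _).1 h0.
have hz : h w @[w --> (0 : C R)^'] --> (0 : C R) by apply: cvg_near_cst; exact: hn.
exact: cvg_dnbhs_unique hc hz.
Qed.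

(** * Homogeneous parts of a rational symmetry *)

Section RationalSymmetry.
Context (R : realType) (U : set (CP1 R)) (U_open : open U)
  (K : set (C R -> C R)) (K_field : function_field U K)
  (n : nat) (A : 'M[C R -> C R]_n) (A_K : forall i j, K (A i j))
  (K_rat : forall P Q : {poly C R}, Q != 0 -> K (fun x => P.[x] / Q.[x]))
  (Y : rat_vfield R n) (Q P0 : {mpoly (C R)[1 + n]}) (P : 'I_n -> {mpoly (C R)[1 + n]})
  (x0 : C R) (Q_x0 : Q.@[coords (x0, 0)] != 0)
  (Y1E : Y.1 = tofrac P0 / tofrac Q) (Y2E : forall i, Y.2 i = tofrac (P i) / tofrac Q).

Let Qy := lift_y (n := n) Q.
Let X := system_field A.
Definition sys_poly i : {mpoly (C R -> C R)[n]} := \sum_j (A i j)%:MP * 'X_j.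
(* The numerator Q W_i of the vertical part of Y. *)
Let Nm i := lift_y (P i) - lift_y P0 * sys_poly i.
Let qf x := ev (x, 0) Qy.
(* The regular points. *)
Let O : set (C R) := [set x | [/\ affine_part U x, qf x != 0 & forall i j, analytic_at (A i j) x]].

Lemma ev_sys_poly i (q : phase R n) : ev q (sys_poly i) = (X q).2 0 i.
Proof.
rewrite mxE rmorph_sum; apply: eq_bigr => j _ /=.
by rewrite rmorphM /= evC evX.
Qed.

(** [qf] as a polynomial, which shows that its zeros are isolated, also near infinity, and
    that its inverse belongs to [K]. *)
Definition den_poly : {poly C R} :=
  mmap polyC (fun i : 'I_(1 + n) => if fintype.split i is inl _ then 'X else 0) Q.

Lemma horner_den_poly x : den_poly.[x] = qf x.
Proof.
rewrite horner_mmap /qf ev_lift_y; apply: meval_eq => i.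
rewrite /coords mxE; case: fintype.split => [k|j]; last by rewrite horner0 mxE.
by rewrite hornerX mxE (ord1 k) eqxx mulr1n.
Qed.

Lemma den_poly_neq0 : den_poly != 0.
Proof.
apply: contraNneq Q_x0 => d0; rewrite -ev_lift_y -/(qf x0) -horner_den_poly d0.
by rewrite horner0.
Qed.

(** Points that are not regular are isolated in [U]. *)
Lemma near_regular p : U p -> \forall w \near (0 : C R)^', O (chart_point p w).
Proof.
move=> Up.
have analytic_A : \forall w \near (0 : C R)^',
    forall i j, analytic_at (A i j) (chart_point p w).
  apply: filter_forall => i; apply: filter_forall => j.
  exact: meromorphic_analytic (ff_mero K_field (A_K i j)) Up.
apply: filterS3 (near_chart_affine U_open Up) (near_chart_horner p den_poly_neq0) analytic_A.
by move=> w Uw; rewrite horner_den_poly => Qw Aw; split.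
Qed.

Lemma qf_differentiable x : differentiable qf x.
Proof.
rewrite (_ : qf = horner den_poly); last by apply/funext => y; rewrite horner_den_poly.
elim/poly_ind: den_poly => [|p c IH].
  rewrite (_ : horner 0 = cst 0); first exact: differentiable_cst.
  by apply/funext => y; rewrite horner0.
rewrite (_ : horner _ = horner p * id + cst c); last first.
  by apply/funext => y; rewrite hornerMXaddC.
apply: differentiableD; last exact: differentiable_cst.
by apply: differentiableM => //; exact: ex_diff.
Qed.

Lemma near_regular_self x : O x -> \forall z \near x, O z.
Proof.
move=> [Ux Qx Ax].
have nU : \forall z \near x, affine_part U z.
  by apply: open_nbhs_nbhs; split => //; exact: open_affine_part.
have nQ : \forall z \near x, qf z != 0.
  exact: (differentiable_continuous (qf_differentiable x)) _ (near_neq0 Qx).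
have nA : \forall z \near x, forall i j, analytic_at (A i j) z.
  apply: (@filter_forall _ _ _ (nbhs x) _) => i.
  apply: (@filter_forall _ _ _ (nbhs x) _) => j.
  exact: nbhs_interior (Ax i j).
by apply: filterS3 nU nQ nA => z Uz Qz Az; split.
Qed.

(* Coefficients for which membership in [K] and differentiability at the regular points
   are propagated together. *)
Let S : set (C R -> C R) := [set f | K f /\ forall x, O x -> differentiable f x].

Lemma regular_fun_ring : fun_ring S.
Proof.
split=> [c|f g [Kf df] [Kg dg]|f g [Kf df] [Kg dg]].
- split; first exact: (ff_const K_field).
  by move=> x _; exact: differentiable_cst.
- split; first exact: (ff_sub K_field).
  by move=> x Ox; apply: differentiableB; [exact: df|exact: dg].
- split; first exact: (ff_mul K_field).
  by move=> x Ox; apply: differentiableM; [exact: df|exact: dg].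
Qed.

Lemma regular_id : S id.
Proof.
split=> [|x _]; last exact: ex_diff.
have := K_rat 'X (oner_neq0 _); congr (K _); apply/funext => x.
by rewrite hornerX hornerC divr1.
Qed.

Lemma regular_A i j : S (A i j).
Proof. by split=> // x [_ _ /(_ i j)]; exact: nbhs_singleton. Qed.

Lemma regular_qfV : S (fun x => (qf x)^-1).
Proof.
split=> [|x [_ Qx _]]; last exact: differentiableV (qf_differentiable x) Qx.
have := K_rat 1 den_poly_neq0; congr (K _); apply/funext => x.
by rewrite hornerC div1r horner_den_poly.
Qed.

Lemma coefs_in_Qy : coefs_in S Qy.
Proof. exact: (coefs_in_lift_y _ regular_fun_ring regular_id). Qed.

Lemma coefs_in_sys_poly i : coefs_in S (sys_poly i).
Proof.
apply: coefs_in_sum => [|j _]; first exact: regular_fun_ring.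
apply: (coefs_inM regular_fun_ring); last exact: (coefs_inXm regular_fun_ring).
by apply: coefs_inC; [exact: regular_fun_ring|exact: regular_A].
Qed.

Lemma coefs_in_Nm i : coefs_in S (Nm i).
Proof.
apply: (coefs_inB regular_fun_ring).
  exact: (coefs_in_lift_y _ regular_fun_ring regular_id).
apply: (coefs_inM regular_fun_ring); last exact: coefs_in_sys_poly.
exact: (coefs_in_lift_y _ regular_fun_ring regular_id).
Qed.

Lemma ev_pihomog0 x (v : 'rV[C R]_n) : ev (x, v) (pihomog mdeg 0 Qy) = qf x.
Proof.
rewrite /qf (ev0 x Qy) -[in RHS](scale0r v) (ev_homog _ _ _ (pihomogP _ _ _)).
by rewrite expr0 mul1r.
Qed.

Lemma ev_Nm q i : ev q (Nm i) = (P i).@[coords q] - P0.@[coords q] * (X q).2 0 i.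
Proof.
rewrite /Nm evB evM ev_sys_poly; congr (_ - _ * _); exact: ev_lift_y.
Qed.

Lemma rat_field1E q : Q.@[coords q] != 0 ->
  (rat_field Y q).1 = P0.@[coords q] / Q.@[coords q].
Proof. by move=> Qq; rewrite /= Y1E ratfun_evalE. Qed.

Lemma rat_field2E q i : Q.@[coords q] != 0 ->
  (rat_field Y q).2 0 i = (P i).@[coords q] / Q.@[coords q].
Proof. by move=> Qq; rewrite /= mxE Y2E ratfun_evalE. Qed.

Lemma rat_domE (q : phase R n) : affine_part U q.1 -> Q.@[coords q] != 0 -> rat_dom U Y q.
Proof.
move=> Uq Qq; split=> //; case=> [|[i _]] /=; apply.
  by exists (P0.@[coords q] / Q.@[coords q]); exists P0, Q.
by exists ((P i).@[coords q] / Q.@[coords q]); exists (P i), Q.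
Qed.

Let W q := rat_field Y q - (rat_field Y q).1 *: X q.

Lemma vertical_part q i : Q.@[coords q] != 0 ->
  Q.@[coords q] * (W q).2 0 i = ev q (Nm i).
Proof.
move=> Qq; rewrite /W [(_ - _).2]/(_ - _) !mxE -/(X q).
have -> : ratfun_eval (Y.2 i) q = (P i).@[coords q] / Q.@[coords q].
  by rewrite -(rat_field2E i Qq) mxE.
rewrite ev_Nm /= mxE.
have -> : ratfun_eval Y.1 q = P0.@[coords q] / Q.@[coords q] by rewrite -rat_field1E.
by field.
Qed.

Context (Yr : nat -> poly_vfield R n)
  (Yr_maclaurin : maclaurin (rat_dom U Y `&` system_dom U A) W Yr).

Lemma homogeneous_Yr r i : Yr r i \is r.-homog.
Proof. exact: Yr_maclaurin.1. Qed.

Lemma line_poly_den_neq0 x v : O x -> line_poly (x, v) Qy != 0.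
Proof.
move=> [_ Qx _]; apply: contraNneq Qx => l0.
by rewrite -(ev_pihomog0 x v) -coef_line_poly l0 coef0.
Qed.

Lemma near_line_den x (v : 'rV[C R]_n) : O x ->
  \forall t \near (0 : C R)^', Q.@[coords (x, t *: v)] != 0.
Proof.
move=> Ox; apply: filterS (near_chart_horner (Some 0) (line_poly_den_neq0 v Ox)) => t.
by rewrite /= add0r horner_line_poly ev_lift_y.
Qed.

Lemma component_series (u : nat -> phase R n) (m : nat) i :
  (series u m).2 0 i = series (fun k => (u k).2 0 i) m.
Proof.
rewrite /series /=; elim: m => [|m IH]; first by rewrite !big_nil mxE.
by rewrite !big_nat_recr//= mxE IH.
Qed.

(** The Maclaurin series restricted to a line through [(x, 0)] is a power series in [t],
    by homogeneity of its terms. *)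
Lemma series_line x (v : 'rV[C R]_n) i : O x ->
  \forall t \near (0 : C R)^',
    series (fun k => ev (x, v) (Yr k i) * t ^+ k) @ \oo --> (W (x, t *: v)).2 0 i.
Proof.
move=> [Ux Qx Ax].
have Dx : (rat_dom U Y `&` system_dom U A) (x, 0).
  by split; [apply: rat_domE; [exact: Ux|rewrite -ev_lift_y; exact: Qx]|split].
have := near0Z v (Yr_maclaurin.2 x Dx) => near_t; apply: nbhs_dnbhs.
move: near_t; apply: filterS => t.
have cc : {for W (x, t *: v), continuous (fun p : phase R n => p.2 0 i)}.
  exact: continuous_component.
move=> /(continuous_cvg _ cc) lim_i.
have -> : series (fun k => ev (x, v) (Yr k i) * t ^+ k) =
    (fun n0 => (series (fun r => vertical_field (Yr r) (x, t *: v)) n0).2 0 i).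
  apply/funext => m; rewrite component_series; congr (series _ m).
  apply/funext => k; rewrite mxE mulrC -(ev_homog x t v (homogeneous_Yr k i)).
  by [].
exact: lim_i.
Qed.

(** Coefficients of [t ^+ r] in [Q (x, t v) W_i (x, t v) = N_i (x, t v)]. *)
Lemma den_mul_recurrence x (v : 'rV[C R]_n) i r : O x ->
  ev (x, v) (pihomog mdeg r (Nm i)) =
  \sum_(k < r.+1) ev (x, v) (pihomog mdeg k Qy) * ev (x, v) (Yr (r - k) i).
Proof.
move=> Ox; apply: etrans (esym (coef_line_poly (x, v) (Nm i) r)) _.
have line_eq : \forall t \near (0 : C R)^',
    (line_poly (x, v) Qy).[t] * (W (x, t *: v)).2 0 i = (line_poly (x, v) (Nm i)).[t].
  apply: filterS (near_line_den v Ox) => t Qt.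
  apply: etrans (esym (horner_line_poly _ _ _ _)).
  apply: etrans (vertical_part i Qt); congr (_ * _).
  apply: etrans (horner_line_poly _ _ _ _) _; exact: ev_lift_y.
apply: etrans (pseries_mul_poly (series_line v i Ox) line_eq r) _.
by apply: eq_bigr => k _; congr (_ * _); exact: coef_line_poly.
Qed.

(** The recurrence determines [Yr r] from the previous terms after division by [qf x];
    read as an identity between polynomials over [K], it produces [z]. *)
Lemma Yr_regular i r : exists z : {mpoly (C R -> C R)[n]},
  coefs_in S z /\ forall x v, O x -> ev (x, v) (Yr r i) = ev (x, v) z.
Proof.
elim/ltn_ind: r => r IH.
have /choice[z zP] : forall s, exists z : {mpoly (C R -> C R)[n]}, (s < r)%N ->
    coefs_in S z /\ forall x v, O x -> ev (x, v) (Yr s i) = ev (x, v) z.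
  move=> s; case: (ltnP s r) => [/IH [z zP]|_]; first by exists z.
  by exists 0.
exists ((fun x => (qf x)^-1)%:MP * (pihomog mdeg r (Nm i) -
   \sum_(k < r) pihomog mdeg k.+1 Qy * z (r - k.+1)%N)); split.
  apply: (coefs_inM regular_fun_ring).
    by apply: coefs_inC; [exact: regular_fun_ring|exact: regular_qfV].
  apply: (coefs_inB regular_fun_ring).
    by apply: coefs_in_pihomog; [exact: regular_fun_ring|exact: coefs_in_Nm].
  apply: coefs_in_sum => [|k _]; first exact: regular_fun_ring.
  apply: (coefs_inM regular_fun_ring).
    by apply: coefs_in_pihomog; [exact: regular_fun_ring|exact: coefs_in_Qy].
  have /zP[] // : (r - k.+1 < r)%N.
  by rewrite ltn_subrL /=; apply: leq_ltn_trans (ltn_ord k).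
move=> x v Ox; have [_ Qx _] := Ox.
rewrite evM evB evC /= (den_mul_recurrence v i r Ox) big_ord_recl ev_pihomog0 subn0.
rewrite [ev _ (\sum_(_ < _) _)](rmorph_sum (ev (x, v))) /=.
rewrite [X in _ + _ - X](eq_bigr (fun k : 'I_r => ev (x, v) (pihomog mdeg (lift ord0 k) Qy) *
   ev (x, v) (Yr (r - lift ord0 k) i))) => [|k _].
  by rewrite addrK mulKf.
rewrite evM; congr (_ * _).
have /zP[_ ->] // : (r - k.+1 < r)%N.
by rewrite ltn_subrL /=; apply: leq_ltn_trans (ltn_ord k).
Qed.

(** Two polynomials in [y] with the same values have the same coefficients. *)
Lemma Yr_coef i r m : exists2 c, S c & forall x, O x -> (Yr r i)@_m x = c x.
Proof.
have [z [zS zE]] := Yr_regular i r; exists z@_m => [|x Ox]; first exact: zS.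
apply/eqP; rewrite -subr_eq0 -[_ - _]/((Yr r i)@_m x - z@_m x).
have := @ev_eq0 _ _ x (Yr r i - z) _ m; rewrite mcoeffB => /= H; apply/eqP; apply: H => v.
by rewrite evB (zE _ v Ox) subrr.
Qed.

Lemma Yr_K i r m : K (Yr r i)@_m.
Proof.
have [c [Kc _] cE] := Yr_coef i r m; apply: (ff_sat K_field Kc) => p Up.
apply: filterS (near_regular Up) => w Ow.
by rewrite !in_chartE cE.
Qed.

Lemma regular_differentiable z x : coefs_in S z -> O x ->
  forall m, differentiable (z : {mpoly (C R -> C R)[n]})@_m x.
Proof. by move=> zS Ox m; have [_] := zS m; apply. Qed.

Lemma sys_is_derive q u i : (forall j, differentiable (A i j) q.1) ->
  is_derive q u (fun p => (X p).2 0 i)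
    (u.1 * \sum_j derive1 (A i j) q.1 * q.2 0 j + \sum_j A i j q.1 * u.2 0 j).
Proof.
move=> Aq; rewrite mulr_sumr -big_split /=.
rewrite (_ : (fun p => _) = (fun p : phase R n => \sum_j A i j p.1 * p.2 0 j)); last first.
  by apply/funext => p; rewrite mxE.
apply: is_derive_sum_seq => j.
apply: is_derive_eq (is_deriveM (is_derive_fst u (Aq j)) (is_derive_coord q u j)) _.
rewrite addrC; congr (_ + _).
by rewrite -[LHS]/(q.2 0 j * (u.1 * derive1 (A i j) q.1)) mulrC mulrA.
Qed.

Lemma sys_differentiable q : (forall i j, differentiable (A i j) q.1) -> differentiable X q.
Proof.
move=> Aq; apply: differentiable_phase => [|i]; first exact: differentiable_cst.
rewrite (_ : (fun p => _) = (fun p : phase R n => \sum_j A i j p.1 * p.2 0 j)); last first.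
  by apply/funext => p; rewrite mxE.
apply: differentiable_sum_seq => j; apply: differentiableM.
  by have [d1 _] := is_diff_fst q; exact: differentiable_comp d1 (Aq i j).
have idq : differentiable (id : vfield R n) q by exact: ex_diff.
exact: differentiable_component idq.
Qed.

Context (Y_sym : infinitesimal_symmetry U A (rat_dom U Y) (rat_field Y)).

(** Near [q] the components of Y are the fractions [P / Q].  The [x]-component of the linear
    relation between [Y, X] and X gives the coefficient of X, because the
    [x]-component of X is constant; [symmetry_algebra] then turns the
    [y_i]-component into an identity between polynomials. *)
Lemma numerator_pde q i : O q.1 -> ev q Qy != 0 ->
  'D_(X q) (fun p => ev p (Nm i)) q * ev q Qy
    - ev q (Nm i) * 'D_(X q) (fun p => ev p Qy) q
  = ev q Qy * \sum_j A i j q.1 * ev q (Nm j).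
Proof.
move=> Oq Qq; have [Uq _ Aq] := Oq.
have Qq' : Q.@[coords q] != 0 by rewrite -ev_lift_y.
have Dq : rat_dom U Y q by exact: rat_domE.
have Sq : system_dom U A q by split.
have [_ _ /(_ q Dq) /nbhs_singleton dY /(_ q Dq Sq)] := Y_sym.
have dA j k : differentiable (A j k) q.1 by exact: nbhs_singleton (Aq j k).
have dX := sys_differentiable dA.
move=> [a [b [ab0 ab]]].
set B := lie_bracket _ _ _ in ab.
have ab1 : a * B.1 + b = 0 by have := congr1 fst ab; rewrite -[LHS]/(a * B.1 + b * 1) mulr1.
have a0 : a != 0.
  apply: contraNneq ab0 => a0; move: ab1; rewrite a0 mul0r add0r => ->.
  by [].
have B2 : B.2 0 i = B.1 * (X q).2 0 i.
  have bE : b = - (a * B.1) by apply/eqP; rewrite -addr_eq0 addrC ab1.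
  apply: (mulfI a0); have := congr1 (fun p : phase R n => p.2 0 i) ab.
  rewrite [LHS](_ : _ = a * B.2 0 i + b * (X q).2 0 i); last by rewrite !mxE.
  rewrite [RHS]mxE bE mulNr => /eqP; rewrite subr_eq0 => /eqP ->.
  by rewrite mulrA.
have dP (T : {mpoly (C R)[1 + n]}) u : is_derive q u (fun p => ev p (lift_y T))
    ('D_u (fun p => ev p (lift_y T)) q).
  apply: derivableP; apply: diff_derivable; apply: ev_differentiable.
  exact: (regular_differentiable (coefs_in_lift_y T regular_fun_ring regular_id) Oq).
have nQ : \forall p \near q, ev p Qy != 0.
  have cQ : {for q, continuous (fun p : phase R n => ev p Qy)}.
    apply: differentiable_continuous; apply: ev_differentiable.
    exact: (regular_differentiable coefs_in_Qy Oq).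
  exact: cQ _ (near_neq0 Qq).
have d1 u : 'D_u (fun p => (rat_field Y p).1) q =
   ('D_u (fun p => ev p (lift_y P0)) q * ev q Qy - ev q (lift_y P0) * 'D_u (fun p => ev p Qy) q)
     / ev q Qy ^+ 2.
  have := is_derive_quot (dP P0 u) (dP Q u) Qq => /(@derive_val _ _ _ _ _ _ _) <-.
  apply: near_eq_derive; apply: filterS nQ => p Qp.
  have Qp' : Q.@[coords p] != 0 by rewrite -ev_lift_y.
  apply: etrans (rat_field1E Qp') _.
  by congr (_ / _); exact: esym (ev_lift_y _ _).
have d2 u : 'D_u (fun p => (rat_field Y p).2 0 i) q =
   ('D_u (fun p => ev p (lift_y (P i))) q * ev q Qy
      - ev q (lift_y (P i)) * 'D_u (fun p => ev p Qy) q)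
     / ev q Qy ^+ 2.
  have := is_derive_quot (dP (P i) u) (dP Q u) Qq => /(@derive_val _ _ _ _ _ _ _) <-.
  apply: near_eq_derive; apply: filterS nQ => p Qp.
  have Qp' : Q.@[coords p] != 0 by rewrite -ev_lift_y.
  apply: etrans (rat_field2E i Qp') _.
  by congr (_ / _); exact: esym (ev_lift_y _ _).
have B1E : B.1 = - 'D_(X q) (fun p => (rat_field Y p).1) q.
  have e1 : ('D_(rat_field Y q) X q).1 = 0.
    apply: etrans (derive_component1 _ dX) _; exact: (derive_cst (1 : C R)).
  have e2 := derive_component1 (X q) dY.
  by apply: etrans (congr2 (fun a b => a - b) e1 e2) _; rewrite sub0r.
have B2E : B.2 0 i = 'D_(rat_field Y q) (fun p => (X p).2 0 i) q
     - 'D_(X q) (fun p => (rat_field Y p).2 0 i) q.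
  have e1 := derive_component (rat_field Y q) i dX.
  have e2 := derive_component (X q) i dY.
  apply: etrans (congr2 (fun a b => a - b) e1 e2).
  by rewrite !mxE.
pose p0 := ev q (lift_y P0); pose p j := ev q (lift_y (P j)).
pose a' := \sum_j derive1 (A i j) q.1 * q.2 0 j.
pose sp := \sum_j A i j q.1 * p j.
pose sf := \sum_j A i j q.1 * (X q).2 0 j.
have DF u := @derive_val _ _ _ _ _ _ _ (sys_is_derive u (dA i)).
have DYF : 'D_(rat_field Y q) (fun p => (X p).2 0 i) q
    = p0 / ev q Qy * a' + sp / ev q Qy.
  apply: etrans (DF (rat_field Y q)) _; congr (_ * _ + _).
    by apply: etrans (rat_field1E Qq') _; congr (_ / _); exact: esym (ev_lift_y _ _).
  rewrite /sp mulr_suml; apply: eq_bigr => j _; rewrite -mulrA; congr (_ * _).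
  by apply: etrans (rat_field2E j Qq') _; congr (_ / _); exact: esym (ev_lift_y _ _).
have evN p' j : ev p' (Nm j) = ev p' (lift_y (P j)) - ev p' (lift_y P0) * (X p').2 0 j.
  by rewrite /Nm evB evM ev_sys_poly.
have DN : 'D_(X q) (fun p => ev p (Nm i)) q = 'D_(X q) (fun p => ev p (lift_y (P i))) q
   - ('D_(X q) (fun p => ev p (lift_y P0)) q * (X q).2 0 i + p0 * (a' + sf)).
  rewrite (_ : (fun p => ev p (Nm i)) = (fun p => ev p (lift_y (P i)))
      - (fun p => ev p (lift_y P0)) * (fun p => (X p).2 0 i)); last first.
    by apply/funext => p'; exact: evN.
  have H := is_deriveB (dP (P i) (X q)) (is_deriveM (dP P0 (X q)) (sys_is_derive (X q) (dA i))).
  apply: etrans (@derive_val _ _ _ _ _ _ _ H) _; congr (_ - _); rewrite addrC.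
  congr (_ + _); first exact: mulrC.
  by congr (_ * (_ + _)); exact: mul1r.
have sN : \sum_j A i j q.1 * ev q (Nm j) = sp - p0 * sf.
  rewrite /sp /sf mulr_sumr -sumrB; apply: eq_bigr => j _.
  by rewrite evN mulrBr; congr (_ - _); exact: mulrCA.
rewrite DN sN evN.
apply: (@symmetry_algebra (C R) p0 (p i) (ev q Qy) ((X q).2 0 i) a' sp sf
  ('D_(X q) (fun p => ev p (lift_y P0)) q) ('D_(X q) (fun p => ev p (lift_y (P i))) q)
  ('D_(X q) (fun p => ev p Qy) q) Qq).
have E := etrans (esym B2E) (etrans B2 (congr1 (fun b => b * (X q).2 0 i) B1E)).
apply: etrans (esym (congr2 (fun b c => b - c) DYF (d2 (X q)))) _.
exact: etrans E (congr1 (fun b => - b * (X q).2 0 i) (d1 (X q))).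
Qed.

Definition flow_derive (x : C R) (v : 'rV[C R]_n) (z : {mpoly (C R -> C R)[n]}) : C R :=
  'D_(X (x, v)) (fun p => ev p z) (x, v).

Lemma flow_is_derive x v z : coefs_in S z -> O x ->
  is_derive (x, v) (X (x, v)) (fun p => ev p z) (flow_derive x v z).
Proof.
move=> zS Ox; apply: derivableP; apply: diff_derivable; apply: ev_differentiable.
exact: regular_differentiable zS Ox.
Qed.

Lemma system_field_line x t v : X (x, t *: v) = (1, t *: (X (x, v)).2).
Proof.
congr (_, _); apply/rowP => i; rewrite !mxE mulr_sumr; apply: eq_bigr => j _.
by rewrite /= !mxE mulrCA.
Qed.

(** The derivative along X of [z], restricted to the line [t |-> (x, t *: v)]. *)
Definition flow_line (x : C R) (v : 'rV[C R]_n) (z : {mpoly (C R -> C R)[n]}) : {poly C R} :=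
  \poly_(d < msize z) flow_derive x v (pihomog mdeg d z).

Lemma coef_flow_line x v z r : (flow_line x v z)`_r = flow_derive x v (pihomog mdeg r z).
Proof.
rewrite coef_poly; case: (ltnP r (msize z)) => // zr.
have -> : pihomog mdeg r z = 0.
  rewrite pihomogE big_seq_cond big_pred0// => m.
  apply/negbTE; rewrite negb_and -implybE; apply/implyP => /msize_mdeg_lt mz.
  by rewrite neq_ltn (leq_trans mz zr).
rewrite /flow_derive (_ : (fun p => ev p 0) = cst 0); first exact: esym (derive_cst _ _ _).
by apply/funext => p; exact: rmorph0.
Qed.

Lemma horner_flow_line x t v z : coefs_in S z -> O x ->
  'D_(X (x, t *: v)) (fun p => ev p z) (x, t *: v) = (flow_line x v z).[t].
Proof.
move=> zS Ox.
have zE := @pihomog_partitionE n _ mdeg (msize z) z (leqnn _).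
have zdS d : coefs_in S (pihomog mdeg d z).
  by apply: coefs_in_pihomog; [exact: regular_fun_ring|].
have evE p : ev p z = \sum_(d < msize z) ev p (pihomog mdeg d z).
  by apply: etrans (congr1 (ev p) zE) _; exact: rmorph_sum.
rewrite (funext evE) horner_poly system_field_line.
have H (d : 'I_(msize z)) := derive_homog (f := fun p => ev p (pihomog mdeg d z)) (t := t)
   (fun x v => ev_homog x t v (pihomogP _ d z)) (@ex_derive _ _ _ _ _ _ _ (flow_is_derive v (zdS d) Ox)).
apply: etrans (@derive_val _ _ _ _ _ _ _ (is_derive_sum_seq (index_enum _) H)) _.
by apply: eq_bigr => d _; rewrite mulrC.
Qed.

Lemma near_regular_phase x (v : 'rV[C R]_n) :
  O x -> \forall p \near ((x, v) : phase R n), O p.1.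
Proof.
move=> Ox.
have c : {for ((x, v) : phase R n), continuous (fun p : phase R n => p.1)}.
  exact: continuous_linear_fst.
have nO := near_regular_self Ox.
exact: (@near_fun _ _ _ _ O c nO).
Qed.

Lemma Yr_is_derive x v i r : O x ->
  is_derive (x, v) (X (x, v)) (fun p => ev p (Yr r i)) (flow_derive x v (Yr r i)).
Proof.
move=> Ox; apply: derivableP; have [z [zS zE]] := Yr_regular i r.
apply: near_eq_derivable (@ex_derive _ _ _ _ _ _ _ (flow_is_derive v zS Ox)).
apply: filterS (near_regular_phase v Ox) => -[p w] Op.
by rewrite zE.
Qed.

(** [den_mul_recurrence] holds in a neighbourhood of [(x, v)], so it may be differentiated. *)
Lemma flow_recurrence x v i r : O x ->
  flow_derive x v (pihomog mdeg r (Nm i)) = \sum_(k < r.+1)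
    (ev (x, v) (pihomog mdeg k Qy) * flow_derive x v (Yr (r - k)%N i)
     + ev (x, v) (Yr (r - k)%N i) * flow_derive x v (pihomog mdeg k Qy)).
Proof.
move=> Ox.
have zdS d : coefs_in S (pihomog mdeg d Qy).
  by apply: coefs_in_pihomog; [exact: regular_fun_ring|exact: coefs_in_Qy].
have H (k : 'I_r.+1) := is_deriveM (flow_is_derive v (zdS k) Ox) (Yr_is_derive v i (r - k)%N Ox).
apply: etrans (@derive_val _ _ _ _ _ _ _ (is_derive_sum_seq (index_enum _) H)).
apply: near_eq_derive; apply: filterS (near_regular_phase v Ox) => -[p w] Op.
exact: den_mul_recurrence.
Qed.

(** [numerator_pde] divided by [Q] on the line [t |-> (x, t *: v)]; its terms are polynomials
    in [t], except for [W_i], which is the sum of the Maclaurin series. *)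
Lemma flow_pde x v i r : O x ->
  flow_derive x v (pihomog mdeg r (Nm i))
    - \sum_j A i j x * ev (x, v) (pihomog mdeg r (Nm j))
  = \sum_(k < r.+1) flow_derive x v (pihomog mdeg k Qy) * ev (x, v) (Yr (r - k) i).
Proof.
move=> Ox.
pose s := flow_line x v (Nm i) - \sum_j A i j x *: line_poly (x, v) (Nm j).
have line_eq : \forall t \near (0 : C R)^',
    (flow_line x v Qy).[t] * (W (x, t *: v)).2 0 i = s.[t].
  apply: filterS (near_line_den v Ox) => t Qt.
  have Qt' : ev (x, t *: v) Qy != 0 by rewrite ev_lift_y.
  have e1 := horner_flow_line t v coefs_in_Qy Ox.
  have e2 := horner_flow_line t v (coefs_in_Nm i) Ox.
  have e3 : ev (x, t *: v) Qy * (W (x, t *: v)).2 0 i = ev (x, t *: v) (Nm i).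
    by apply: etrans (vertical_part i Qt); congr (_ * _); exact: ev_lift_y.
  have e4 : (flow_line x v (Nm i)).[t] * ev (x, t *: v) Qy
      - ev (x, t *: v) (Nm i) * (flow_line x v Qy).[t]
      = ev (x, t *: v) Qy * \sum_j A i j x * ev (x, t *: v) (Nm j).
    apply: etrans (@numerator_pde (x, t *: v) i Ox Qt').
    exact: (congr2 (fun b c => b * ev (x, t *: v) Qy - ev (x, t *: v) (Nm i) * c)
      (esym e2) (esym e1)).
  have e5 : s.[t] = (flow_line x v (Nm i)).[t] - \sum_j A i j x * ev (x, t *: v) (Nm j).
    rewrite /s hornerD hornerN horner_sum; congr (_ - _).
    by apply: eq_bigr => j _; rewrite hornerZ; congr (_ * _); exact: horner_line_poly.
  exact: etrans (quotient_rule Qt' e3 e4) (esym e5).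
have es : s`_r = flow_derive x v (pihomog mdeg r (Nm i))
    - \sum_j A i j x * ev (x, v) (pihomog mdeg r (Nm j)).
  rewrite /s coefB coef_sum; congr (_ - _); first exact: coef_flow_line.
  by apply: eq_bigr => j _; rewrite coefZ; congr (_ * _); exact: coef_line_poly.
apply: etrans (esym es) _.
apply: etrans (pseries_mul_poly (series_line v i Ox) line_eq r) _.
by apply: eq_bigr => k _; congr (_ * _); exact: coef_flow_line.
Qed.

(** The defects [u s] satisfy [sum_k Q_k u_(r - k) = 0] with [Q_0] invertible, hence vanish one
    after the other. *)
Lemma Yr_flow x v i r : O x ->
  flow_derive x v (Yr r i) = \sum_j A i j x * ev (x, v) (Yr r j).
Proof.
move=> Ox; have [_ Qx _] := Ox.
pose u s := flow_derive x v (Yr s i) - \sum_j A i j x * ev (x, v) (Yr s j).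
suff : u r = 0 by move/eqP; rewrite subr_eq0 => /eqP.
elim/ltn_ind: r => r IH.
have : \sum_(k < r.+1) ev (x, v) (pihomog mdeg k Qy) * u (r - k)%N = 0.
  pose y s := \sum_j A i j x * ev (x, v) (Yr s j).
  have sigma : \sum_j A i j x * ev (x, v) (pihomog mdeg r (Nm j)) =
      \sum_(k < r.+1) ev (x, v) (pihomog mdeg k Qy) * y (r - k)%N.
    transitivity (\sum_j \sum_(k < r.+1)
        A i j x * (ev (x, v) (pihomog mdeg k Qy) * ev (x, v) (Yr (r - k)%N j))).
      by apply: eq_bigr => j _; rewrite -mulr_sumr; congr (_ * _); exact: den_mul_recurrence.
    rewrite exchange_big; apply: eq_bigr => k _; rewrite mulr_sumr.
    by apply: eq_bigr => j _; exact: mulrCA.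
  apply: (@convolution_cancel (C R) r (fun k => ev (x, v) (pihomog mdeg k Qy))
    (fun k => flow_derive x v (pihomog mdeg k Qy)) (fun s => ev (x, v) (Yr s i))
    (fun s => flow_derive x v (Yr s i)) y _ _ sigma).
  apply: etrans (flow_pde v i r Ox); congr (_ - _).
  exact: esym (flow_recurrence v i r Ox).
rewrite big_ord_recl big1 => [|k _].
  rewrite addr0 ev_pihomog0 subn0 => /eqP; rewrite mulf_eq0 (negbTE Qx) /=.
  by move/eqP.
rewrite IH ?mulr0// ltn_subrL /=; apply: leq_ltn_trans (ltn_ord k).
by [].
Qed.

Lemma Yr_coef_differentiable x r i m : O x -> differentiable (Yr r i)@_m x.
Proof.
move=> Ox; have [c [_ dc] cE] := Yr_coef i r m.
apply: near_differentiable (dc x Ox).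
by apply: filterS (near_regular_self Ox) => z Oz; rewrite cE.
Qed.

(** The equation at [q] is the limit of the equations at the nearby regular points, where
    [Yr_flow] applies: the difference [g] of its two sides is continuous in [x]. *)
Lemma Yr_transport r i q : system_dom U A q -> poly_dom U (Yr r) q ->
  'D_(X q) (fun p => ev p (Yr r i)) q = \sum_j A i j q.1 * ev q (Yr r j).
Proof.
move=> [Uq Aq] [_ Yq]; case: q Uq Aq Yq => a v /= Ua Aa Ya.
have dA j k : differentiable (A j k) a by exact: nbhs_singleton (Aa j k).
have dY j m : differentiable (Yr r j)@_m a by exact: nbhs_singleton (Ya j m).
pose g x := ev_dx (x, v) (Yr r i) + ev_dy (x, v) (Yr r i) (X (x, v)).2
   - \sum_j A i j x * ev (x, v) (Yr r j).
have gE x : (forall m, differentiable (Yr r i)@_m x) ->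
    'D_(X (x, v)) (fun p => ev p (Yr r i)) (x, v) - \sum_j A i j x * ev (x, v) (Yr r j) = g x.
  move=> dx; congr (_ - _).
  have H : forall m, differentiable (Yr r i)@_m ((x, v) : phase R n).1 by [].
  apply: etrans (@derive_val _ _ _ _ _ _ _ (ev_is_derive (X (x, v)) H)) _.
  by rewrite mul1r.
suff ga : g a = 0.
  by apply/eqP; rewrite -subr_eq0; apply/eqP; apply: etrans (gE a (dY i)) ga.
have cy : {for a, continuous (fun x : C R => ((x, v) : phase R n))}.
  apply: differentiable_continuous; apply: differentiable_pair; first exact: ex_diff.
  exact: differentiable_cst.
have cX : {for a, continuous (fun x : C R => (X (x, v)).2)}.
  have dX : differentiable X (a, v) by exact: sys_differentiable.
  have cX2 : {for ((a, v) : phase R n), continuous (fun p : phase R n => (X p).2)}.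
    have c2 : {for X (a, v), continuous (snd : phase R n -> 'rV[C R]_n)}.
      by move=> z; exact: cvg_snd.
    exact: (@continuous_comp _ _ _ X snd _ (differentiable_continuous dX) c2).
  exact: (@continuous_comp _ _ _ (fun x : C R => ((x, v) : phase R n))
    (fun p : phase R n => (X p).2) a cy cX2).
have cd (f : C R -> C R) : differentiable f a -> {for a, continuous f}.
  exact: differentiable_continuous.
have c1 : {for a, continuous (fun x => ev_dx ((x, v) : phase R n) (Yr r i))}.
  apply: continuous_sum_seq => m.
  have cm := derive1_meromorphic_continuous (ff_mero K_field (Yr_K i r m)) Ua (Ya i m).
  exact: cvgM cm (cvg_cst _).
have c2 : {for a, continuous (fun x => ev_dy ((x, v) : phase R n) (Yr r i) (X (x, v)).2)}.
  apply: continuous_sum_seq => m.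
  have cm : {for (X (a, v)).2, continuous ('d (@mon R n m) v)}.
    exact: diff_continuous (differentiable_mon m v) _.
  have cXm := @continuous_comp _ _ _ (fun x : C R => (X (x, v)).2) _ a cX cm.
  exact: cvgM (cd _ (dY i m)) cXm.
have c3 : {for a, continuous (fun x => \sum_j A i j x * ev ((x, v) : phase R n) (Yr r j))}.
  apply: continuous_sum_seq => j.
  have ce : {for a, continuous (fun x => ev ((x, v) : phase R n) (Yr r j))}.
    apply: continuous_sum_seq => m.
    exact: cvgM (cd _ (dY j m)) (cvg_cst _).
  exact: cvgM (cd _ (dA i j)) ce.
have cg : {for a, continuous g} by exact: cvgB (cvgD c1 c2) c3.
have := @near_dnbhs_eq0 _ (fun w => g (a + w)); rewrite addr0; apply.
  apply: continuous_comp; first exact: continuous_addl.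
  by rewrite addr0.
apply: filterS (near_regular (p := Some a) Ua) => w /= Ow.
rewrite -gE => [|m]; last exact: Yr_coef_differentiable.
apply/eqP; rewrite subr_eq0; apply/eqP; exact: Yr_flow.
Qed.

Lemma Yr_lie_bracket r q : system_dom U A q -> poly_dom U (Yr r) q ->
  lie_bracket X (vertical_field (Yr r)) q = 0.
Proof.
move=> Sq Pq; have [Uq Aq] := Sq; have [_ Yq] := Pq.
have dA j k : differentiable (A j k) q.1 by exact: nbhs_singleton (Aq j k).
have dY j m : differentiable (Yr r j)@_m q.1 by exact: nbhs_singleton (Yq j m).
have dX := sys_differentiable dA.
pose V := vertical_field (Yr r).
have V2 p i : (V p).2 0 i = ev p (Yr r i) by rewrite mxE.
have dV : differentiable V q.
  apply: differentiable_phase => [|i]; first exact: differentiable_cst.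
  by rewrite (funext (fun p => V2 p i)); exact: ev_differentiable.
have e1 : (lie_bracket X V q).1 = 0.
  apply: etrans (congr2 (fun a b => a - b) (derive_component1 (X q) dV)
    (derive_component1 (V q) dX)) _.
  apply: etrans (congr2 (fun a b => a - b) (derive_cst (0 : C R) _ _)
    (derive_cst (1 : C R) _ _)) _.
  exact: subrr.
have e2 i : (lie_bracket X V q).2 0 i = 0.
  have E : (lie_bracket X V q).2 0 i = ('D_(X q) V q).2 0 i - ('D_(V q) X q).2 0 i.
    by rewrite !mxE.
  apply: etrans E _.
  apply: etrans (congr2 (fun a b => a - b) (derive_component (X q) i dV)
    (derive_component (V q) i dX)) _.
  have e3 : 'D_(X q) (fun p => (V p).2 0 i) q = \sum_j A i j q.1 * ev q (Yr r j).
    by rewrite (funext (fun p => V2 p i)); exact: Yr_transport.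
  have e4 : 'D_(V q) (fun p => (X p).2 0 i) q = \sum_j A i j q.1 * ev q (Yr r j).
    apply: etrans (@derive_val _ _ _ _ _ _ _ (sys_is_derive (V q) (dA i))) _.
    rewrite [X in X + _]mul0r add0r; apply: eq_bigr => j _; congr (_ * _); exact: V2.
  by apply: etrans (congr2 (fun a b => a - b) e3 e4) _; exact: subrr.
rewrite [LHS]surjective_pairing; congr (_, _); first exact: e1.
by apply/rowP => i; rewrite [RHS]mxE; exact: e2.
Qed.

Lemma Yr_sym r : sym U K A r (Yr r).
Proof.
split; [by move=> i; exact: homogeneous_Yr|by move=> i m; exact: Yr_K|].
exact: Yr_lie_bracket.
Qed.

Lemma coords_line (q p : phase R n) (w : C R) i :
  coords (q + w *: (p - q)) i = coords q i + w * (coords p i - coords q i).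
Proof.
rewrite /coords !mxE; case: fintype.split => [k|j]; last by rewrite !mxE.
by rewrite !mxE (ord1 k) !eqxx !mulr1n.
Qed.

Lemma near_segment_den (q : phase R n) :
  \forall w \near (0 : C R)^', Q.@[coords (q + w *: ((x0, 0) - q))] != 0.
Proof.
pose T : {poly C R} := mmap polyC (fun i =>
  (coords q i)%:P + 'X * (coords ((x0, 0) : phase R n) i - coords q i)%:P) Q.
have TE w : T.[w] = Q.@[coords (q + w *: ((x0, 0) - q))].
  rewrite horner_mmap; apply: meval_eq => i; rewrite coords_line.
  by rewrite hornerD hornerC hornerM hornerX hornerC.
have T0 : T != 0.
  apply: contraNneq Q_x0 => T0; have := TE 1; rewrite T0 horner0 scale1r.
  by rewrite addrC subrK => <-.
by apply: filterS (near_chart_horner (Some 0) T0) => w; rewrite /= add0r TE.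
Qed.

Lemma near_segment_den_poly (x : C R) :
  \forall w \near (0 : C R)^', qf (x + w * (x0 - x)) != 0.
Proof.
pose T := den_poly \Po (x%:P + 'X * (x0 - x)%:P).
have TE w : T.[w] = qf (x + w * (x0 - x)).
  by rewrite horner_comp horner_den_poly hornerD hornerC hornerM hornerX hornerC.
have T0 : T != 0.
  apply: contraNneq Q_x0 => T0; have := TE 1; rewrite T0 horner0 mul1r.
  by rewrite addrC subrK /qf ev_lift_y => <-.
by apply: filterS (near_chart_horner (Some 0) T0) => w; rewrite /= add0r TE.
Qed.

(** Vanishing as meromorphic functions leaves isolated exceptions, which continuity at
    the regular points removes. *)
Lemma Yr_zero_Nm x (v : 'rV[C R]_n) i :
  (forall r, poly_vfield_zero U (Yr r)) -> O x -> ev (x, v) (Nm i) = 0.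
Proof.
move=> Y0 Ox; have [Ux _ _] := Ox.
have coef0 r j m : (Yr r j)@_m x = 0.
  have := @near_dnbhs_eq0 _ (fun w => (Yr r j)@_m (x + w)); rewrite addr0; apply.
    apply: continuous_comp; first exact: continuous_addl.
    rewrite addr0; apply: differentiable_continuous.
    exact: Yr_coef_differentiable.
  exact: Y0 r j m (Some x) Ux.
have ev0 r : ev (x, v) (Yr r i) = 0.
  by rewrite evE big1// => m _; rewrite [X in X * _]coef0 mul0r.
have coefN r : (line_poly (x, v) (Nm i))`_r = 0.
  apply: etrans (coef_line_poly _ _ _) _.
  apply: etrans (den_mul_recurrence v i r Ox) _.
  by rewrite big1// => k _; rewrite ev0 mulr0.
have := horner_line_poly x 1 v (Nm i); rewrite scale1r => <-.
by rewrite horner_coef big1// => r _; rewrite coefN mul0r.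
Qed.

(** Where the numerators vanish, Y = eta X off the zeros of [Q].  Any [q] is joined to
    [(x0, 0)] by a line on which the zeros of [Q] and of [qf] are isolated, so the equality
    holds at points arbitrarily close to [q], hence at [q]. *)
Lemma Yr_nonzero : ~ characteristic U A (rat_dom U Y) (rat_field Y) ->
  exists r, ~ poly_vfield_zero U (Yr r).
Proof.
move=> nchar; apply: contrapT => /forallNP Y0'.
have Y0 r : poly_vfield_zero U (Yr r) by apply: contrapT; exact: Y0'.
apply: nchar; exists (fun p => (rat_field Y p).1) => q Dq Sq.
have [_ _ /(_ q Dq) aY _] := Y_sym.
split.
  by apply: filterS aY => p; exact: differentiable_component1.
have [Uq Aq] := Sq.
have dY := nbhs_singleton aY.
have dA j k : differentiable (A j k) q.1 by exact: nbhs_singleton (Aq j k).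
have dX := sys_differentiable dA.
suff E i : (rat_field Y q).2 0 i - (rat_field Y q).1 * (X q).2 0 i = 0.
  rewrite [LHS]surjective_pairing; congr (_, _); first exact: esym (mulr1 _).
  apply/rowP => i; rewrite [RHS]mxE; apply/eqP; rewrite -subr_eq0; apply/eqP.
  exact: E.
pose g p := (rat_field Y p).2 0 i - (rat_field Y p).1 * (X p).2 0 i.
pose c (w : C R) : phase R n := q + w *: ((x0, 0) - q).
have c0 : c 0 = q by rewrite /c scale0r addr0.
have cc : {for 0, continuous c}.
  apply: differentiable_continuous; apply: differentiableD.
    exact: differentiable_cst.
  by apply: differentiableZl; exact: ex_diff.
have cg : {for q, continuous g}.
  apply: differentiable_continuous; apply: differentiableB.
    exact: differentiable_component.
  apply: differentiableM; first exact: differentiable_component1.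
  exact: differentiable_component.
have cg0 : {for c 0, continuous g} by rewrite c0.
have gc := @continuous_comp _ _ _ c g 0 cc cg0.
suff : (g \o c) 0 = 0 by rewrite [LHS]/(g (c 0)) c0.
apply: (near_dnbhs_eq0 gc).
have nS1 : \forall x \near q.1, affine_part U x /\ forall i j, analytic_at (A i j) x.
  have nU : \forall z \near q.1, affine_part U z.
    by apply: open_nbhs_nbhs; split => //; exact: open_affine_part.
  have nA : \forall z \near q.1, forall i j, analytic_at (A i j) z.
    apply: (@filter_forall _ _ _ (nbhs q.1) _) => j.
    apply: (@filter_forall _ _ _ (nbhs q.1) _) => k.
    exact: nbhs_interior (Aq j k).
  by apply: filterS2 nU nA => z Uz Az; split.
have c1 : {for (0 : C R), continuous (fun w => (c w).1)}.
  have cfst : {for c 0, continuous (fun p : phase R n => p.1)}.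
    exact: continuous_linear_fst.
  exact: (@continuous_comp _ _ _ c (fun p : phase R n => p.1) 0 cc cfst).
have nSc : \forall w \near (0 : C R)^',
    affine_part U (c w).1 /\ forall i j, analytic_at (A i j) (c w).1.
  apply: nbhs_dnbhs; apply: (@near_fun _ _ _ _
    [set x | affine_part U x /\ forall i j, analytic_at (A i j) x] c1).
  by rewrite c0; exact: nS1.
apply: filterS3 nSc (near_segment_den q) (near_segment_den_poly q.1) => w [Uw Aw] Qw qw.
have Ow : O (c w).1 by split.
have N0 : ev (c w) (Nm i) = 0.
  by rewrite [c w]surjective_pairing; exact: Yr_zero_Nm.
rewrite ev_Nm in N0.
apply: etrans (congr2 (fun a b => a - b * (X (c w)).2 0 i) (rat_field2E i Qw) (rat_field1E Qw)) _.
by rewrite mulrAC -mulrBl N0 mul0r.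
Qed.

End RationalSymmetry.

Theorem proposition3p5 (R : realType) (U : set (CP1 R))
    (U_open : open U) (U_conn : connected U) (U_neq0 : U !=set0)
    (K : set (C R -> C R)) (K_field : function_field U K)
    (n : nat) (n_gt0 : (0 < n)%N)
    (A : 'M[C R -> C R]_n) (A_K : forall i j, K (A i j))
    (K_rat : forall P Q : {poly C R}, Q != 0 -> K (fun x => P.[x] / Q.[x]))
    (Y : rat_vfield R n)
    (Y_sym : infinitesimal_symmetry U A (rat_dom U Y) (rat_field Y))
    (Y_nchar : ~ characteristic U A (rat_dom U Y) (rat_field Y))
    (Y_polar : ~ (zero_curve U `<=` polar_set Y))
    (Yr : nat -> poly_vfield R n)
    (Yr_maclaurin : maclaurin (rat_dom U Y `&` system_dom U A)
       (fun q => rat_field Y q - (rat_field Y q).1 *: system_field A q) Yr) :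
  (forall r, sym U K A r (Yr r)) /\
  (exists r, ~ poly_vfield_zero U (Yr r)).
Proof.
have [[x0 y0] [[/= Ux0 ->]] Yx0] : exists q, zero_curve U q /\ ~ polar_set Y q.
  by apply: contrapT => /forallNP H; apply: Y_polar => q Zq; apply: contrapT => Yq;
    apply: (H q); split.
have [Q [P0 [P [Qx0 Y1E Y2E]]]] := common_denominator Yx0.
split=> [r|].
  exact: (Yr_sym U_open K_field A_K K_rat Qx0 Y1E Y2E Yr_maclaurin Y_sym).
exact: (Yr_nonzero U_open K_field A_K K_rat Qx0 Y1E Y2E Yr_maclaurin Y_sym Y_nchar).
Qed.
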